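(* Let $\frac hk\in Q$, let $\zeta=e^{2\pi i h/k}$, and let $\frac{\alpha}{\beta}$ be one of $\frac{\alpha_1}{\beta_1},\dots,\frac{\alpha_{n-N}}{\beta_{n-N}}$, with $x=e^{2\pi i\alpha/\beta}$. Then $\frac{1}{(\zeta)_\infty}A_3\left(\frac{\alpha}{\beta},-\frac{2h}{k};\frac hk\right)$ converges, and \begin{align*} \frac{1}{(\zeta)_\infty}A_3\left(\frac{\alpha}{\beta},-\frac{2h}{k};\frac hk\right)&=\frac{x^{5/2}}{1-x}R_1(x;\zeta)+x^{3/2}\\ &=\frac{x^{5/2}}{(1-x)\left(1-((1-x^k)(1-x^{-k}))^{-1}\right)}\sum_{0\le s<k}\frac{\zeta^{s^2}}{(x\zeta;\zeta)_s(x^{-1}\zeta;\zeta)_s}+x^{3/2}. \end{align*}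
   Context: Notation: $(a;q)_n:=\prod_{j=1}^n(1-aq^{j-1})$ for $n\in\mathbb N_0\cup\{\infty\}$, and $(q)_\infty:=(q;q)_\infty$. For $\tau\in\mathbb H$, $q=e^{2\pi i\tau}$, the level three Appell function is $A_3(u,v;\tau):=e^{3\pi i u}\sum_{n\in\mathbb Z}\frac{(-1)^n q^{3n(n+1)/2}e^{2\pi i n v}}{1-e^{2\pi i u}q^n}$. The rank generating function is $R_1(w;q):=\sum_{m\ge0}\frac{q^{m^2}}{(wq;q)_m(w^{-1}q;q)_m}$. For $x=e^{2\pi i\alpha/\beta}$, $x^{5/2}:=e^{5\pi i\alpha/\beta}$ and $x^{3/2}:=e^{3\pi i\alpha/\beta}$. Setting: $n\ge2$ and $0\le N\le\lfloor n/2\rfloor$ are integers; for $1\le j\le n-N$, $\alpha_j\in\mathbb Z$, $\beta_j\in\mathbb N$ with $\gcd(\alpha_j,\beta_j)=1$, $\beta_j\nmid\alpha_j$, $\beta_j\nmid 2\alpha_j$, and $\frac{\alpha_r}{\beta_r}\pm\frac{\alpha_s}{\beta_s}\notin\mathbb Z$ for $r\ne s$. The quantum set $Q$ is the set of $\frac hk\in\mathbb Q$ with $h\in\mathbb Z$, $k\in\mathbb N$, $\gcd(h,k)=1$, such that for every $1\le j\le n-N$: $\beta_j\nmid k$ and $\left|\frac{\alpha_j}{\beta_j}k-\left[\frac{\alpha_j}{\beta_j}k\right]\right|>\frac16$, where $[y]$ is a nearest integer to $y$.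
   Formalization: Since (ζ)_∞ = 0 and the series A_3 diverges at τ = h/k, the left-hand side is read as the limit of A_3(α/β, −2τ; τ)/(q)_∞ as τ = h/k + it, t → 0+ (q → ζ radially); convergence of the series R_1(x; ζ) is asserted as well. *)

(* Defs.v *)
From HB Require Import structures.
From mathcomp Require Import all_boot all_order all_algebra.
From mathcomp Require Import all_classical all_reals all_analysis.
From mathcomp Require Import complex.

Set Implicit Arguments.
Unset Strict Implicit.
Unset Printing Implicit Defensive.
Import Order.TTheory GRing.Theory Num.Theory.
Import numFieldNormedType.Exports.
Local Open Scope classical_set_scope.
Local Open Scope ring_scope.

(* The topology of [R[i]] is available on its regular algebra [R[i]^o] only. *)
Notation Cplx R := ((complex R)^o).

Section Functions.
Variable R : realType.
Local Notation C := (Cplx R).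

Definition Cexp (z : C) : C :=
  (expR (complex.Re z) * cos (complex.Im z)
     +i* (expR (complex.Re z) * sin (complex.Im z)))%C.

Definition Cpi_i : C := (0 +i* pi)%C.

Definition qpoch (a q : C) (n : nat) : C :=
  \prod_(1 <= j < n.+1) (1 - a * q ^+ j.-1).

Definition qpoch_infty (a q : C) : C := lim (qpoch a q n @[n --> \oo]).

(* The two one-sided series are summed separately; [Negz n] is [- n.+1]. *)
Definition sum_int (f : int -> C) : C :=
  lim (series (fun n : nat => f (Posz n)) @ \oo)
  + lim (series (fun n : nat => f (Negz n)) @ \oo).

(* The division by 2 in the exponent of [q] is exact. *)
Definition appell3 (u v tau : C) : C :=
  let q := Cexp (2 * Cpi_i * tau) in
  Cexp (3 * Cpi_i * u) *
  sum_int (fun n : int =>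
    (-1) ^ n * q ^ ((3 * n * (n + 1))%R %/ 2)%Z * Cexp (2 * Cpi_i * n%:~R * v)
    / (1 - Cexp (2 * Cpi_i * u) * q ^ n)).

Definition rank_term (w q : C) (m : nat) : C :=
  q ^+ (m ^ 2) / (qpoch (w * q) q m * qpoch (w^-1 * q) q m).

Definition rank_gen (w q : C) : C := lim (series (rank_term w q) @ \oo).

(* [appell3 u (- 2 * tau) tau / (q; q)_oo] for [tau] in the upper half-plane.
   At a rational [tau = r] the denominator vanishes and the bilateral series
   degenerates, so the value there is the limit as [tau -> r] vertically, i.e.
   as [q] tends radially to [exp (2 * pi * i * r)] inside the unit disc. *)
Definition appell3_quot (u tau : C) : C :=
  let q := Cexp (2 * Cpi_i * tau) in
  (qpoch_infty q q)^-1 * appell3 u (- (2 * tau)) tau.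

Definition vertical (r : rat) (t : R) : C := ratr r + (0 +i* t)%C.

End Functions.

Section QuantumSet.
Variables (m : nat) (alpha : 'I_m -> int) (beta : 'I_m -> nat).

Definition alpha_over_beta (j : 'I_m) : rat := (alpha j)%:~R / (beta j)%:R.

Definition admissible : Prop :=
  (forall j, [/\ (0 < beta j)%N,
                 coprimez (alpha j) (beta j),
                 ~~ ((beta j)%:Z %| alpha j)%Z
               & ~~ ((beta j)%:Z %| 2 * alpha j)%Z]) /\
  (forall r s, r != s ->
     alpha_over_beta r + alpha_over_beta s \isn't a Num.int /\ alpha_over_beta r - alpha_over_beta s \isn't a Num.int).

Definition nearest_int (y : rat) (l : int) : Prop :=
  forall l' : int, `|y - l%:~R| <= `|y - l'%:~R|.

Definition quantum_set : set rat :=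
  [set r | exists (h : int) (k : nat),
    [/\ (0 < k)%N, coprimez h k, r = h%:~R / k%:R
      & forall j, ~~ (beta j %| k)%N /\
          exists2 l : int, nearest_int (alpha_over_beta j * k%:R) l
                         & 1 / 6 < `|alpha_over_beta j * k%:R - l%:~R|]].

End QuantumSet.

(* Main.v *)
Require Import Defs.
From HB Require Import structures.
From mathcomp Require Import all_boot all_order all_algebra.
From mathcomp Require Import all_classical all_reals all_analysis.
From mathcomp Require Import complex.
From mathcomp Require Import ring lra zify.

Set Implicit Arguments.
Unset Strict Implicit.
Unset Printing Implicit Defensive.
Import Order.TTheory GRing.Theory Num.Theory.
Import numFieldNormedType.Exports.
Local Open Scope classical_set_scope.
Local Open Scope ring_scope.

(** With [x = exp (2 pi i alpha / beta)] and [|q| < 1] one has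
      [A_3(alpha / beta, - 2 tau; tau) / (q)_oo
        = x^(3/2) (x / (1 - x) * R_1(x; q) + 1)].
    This is the limit [M -> oo] of a finite identity, obtained by inserting the
    Bailey pair [beta_n = [n = 0] + x / ((1 - x) (xq)_n (q/x)_n)] relative to
    [a = 1] into Bailey's lemma; Tannery's theorem justifies the limit.

    For the radial limit, write [q = rho zeta] and [Y = rho^(m k)].  Going from
    the [m]-th to the [(m + k)]-th term of [R_1] multiplies it by at most [Y^2]
    over a product of [2 k] factors which, as [rho -> 1], is uniformly close to
    [|1 - x^k Y|^2 = 1 - 2 Y Re (x^k) + Y^2].  The distance condition defining
    the quantum set says exactly that [Re (x^k) < 1 / 2], so this product exceeds
    [(1 + d) Y^2] for some [d > 0]: the terms decay geometrically, uniformly in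
    [rho], and Tannery's theorem applies again.  At [q = zeta] the ratio is
    exactly [1 / ((1 - x^k) (1 - x^-k))], which sums the series. *)

(** * A finite form of the rank identity *)

Section BilateralSum.
Variable F : fieldType.
Implicit Types f g : int -> F.

(** The window [-L .. L] with [r] and [- r] paired: reflection acts within each pair, and as [L]
    grows the sum is a one-sided series. *)
Definition bsum (L : nat) f : F :=
  f 0 + \sum_(i < L) (f i.+1%:Z + f (- i.+1%:Z)).

Lemma eq_bsum L f g : f =1 g -> bsum L f = bsum L g.
Proof. by move=> e; rewrite /bsum e; congr (_ + _); apply: eq_bigr => i _; rewrite !e. Qed.

Lemma bsumD L f g : bsum L (fun r => f r + g r) = bsum L f + bsum L g.
Proof.
rewrite /bsum addrACA; congr (_ + _); rewrite -big_split /=.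
by apply: eq_bigr => i _; rewrite addrACA.
Qed.

Lemma bsumZ L (c : F) f : bsum L (fun r => c * f r) = c * bsum L f.
Proof.
rewrite /bsum mulrDr mulr_sumr; congr (_ + _).
by apply: eq_bigr => i _; rewrite mulrDr.
Qed.

Lemma bsumN L f : bsum L (fun r => f (- r)) = bsum L f.
Proof.
rewrite /bsum oppr0; congr (_ + _); apply: eq_bigr => i _.
by rewrite opprK addrC.
Qed.

Lemma bsum_exchange L m (f : nat -> int -> F) :
  \sum_(i < m) bsum L (f i) = bsum L (fun r => \sum_(i < m) f i r).
Proof.
rewrite /bsum big_split /=; congr (_ + _); rewrite exchange_big /=.
by apply: eq_bigr => i _; rewrite big_split.
Qed.

Lemma bsum_telescope L f :
  bsum L (fun r => f r - f (r + 1)) = f (- L%:Z) - f (L%:Z + 1).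
Proof.
elim: L => [|L IH]; first by rewrite /bsum big_ord0 addr0 oppr0.
have -> g : bsum L.+1 g = bsum L g + (g L.+1%:Z + g (- L.+1%:Z)).
  by rewrite /bsum big_ord_recr /= addrA.
have e1 : f (L%:Z + 1) = f L.+1%:Z by congr f; lia.
have e2 : f (- L.+1%:Z + 1) = f (- L%:Z) by congr f; lia.
by rewrite IH e1 e2; ring.
Qed.

End BilateralSum.

(** * Two Bailey pairs relative to [a = 1] and a finite Bailey lemma *)

Section FiniteIdentity.
Variables (F : fieldType) (q : F).
Hypotheses (q0 : q != 0) (qN1 : forall n, q ^+ n.+1 != 1).

(** The reciprocal of [(q; q)_m], extended by 0 to negative [m]; the recurrence [qfactVB1] then
    holds for every integer, and the sums below terminate by themselves. *)
Definition qfactV (m : int) : F :=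
  if m is Posz n then (\prod_(i < n) (1 - q ^+ i.+1))^-1 else 0.
Arguments qfactV : simpl never.

Lemma qfactV0 : qfactV 0 = 1.
Proof. by rewrite /qfactV /= big_ord0 invr1. Qed.

Lemma qfactV_lt0 m : m < 0 -> qfactV m = 0.
Proof. by case: m. Qed.

Lemma qfactVB1 m : qfactV (m - 1) = (1 - q ^ m) * qfactV m.
Proof.
case: m => [[|n]|n].
- by rewrite qfactV_lt0 // expr0z subrr mul0r.
- rewrite (_ : n.+1%:Z - 1 = n); last lia.
  rewrite /qfactV big_ord_recr /= invfM mulrCA -exprnP mulfV ?mulr1 //.
  by rewrite subr_eq0 eq_sym qN1.
- by rewrite !qfactV_lt0 ?mulr0 //; lia.
Qed.

Lemma qfactVS (n : nat) : qfactV n = (1 - q ^+ n.+1) * qfactV n.+1.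
Proof. by rewrite exprnP -qfactVB1; congr qfactV; lia. Qed.

(** For [r > 0], [theta r + theta (- r)] is the [alpha_r] of the unit Bailey pair relative to
    [a = 1]. The division is exact. *)
Definition theta (r : int) : F := (-1) ^ r * q ^ ((r * (r - 1)) %/ 2)%Z.

Lemma theta0 : theta 0 = 1.
Proof. by rewrite /theta mul0r div0z !expr0z mulr1. Qed.

Lemma thetaS r : theta (r + 1) = - (q ^ r * theta r).
Proof.
rewrite /theta (_ : (r + 1) * (r + 1 - 1) = r * 2 + r * (r - 1)); last by lia.
rewrite divzMDl // !expfzDr ?oppr_eq0 ?oner_eq0 // expr1z; ring.
Qed.

Lemma thetaN r : theta (- r) = q ^ r * theta r.
Proof.
rewrite /theta (_ : - r * (- r - 1) = r * 2 + r * (r - 1)); last by lia.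
rewrite divzMDl // expfzDr // -exprz_inv invrN1; ring.
Qed.

(** Since [3n(n+1)/2 - 2n = n^2 + n(n-1)/2], the choice [v = - 2 tau] splits the Appell numerator
    into the Bailey weight [q^(n^2)] and [theta n]. *)
Lemma appell3_exponent (n : int) :
  (-1) ^ n * q ^ ((3 * n * (n + 1)) %/ 2)%Z * q ^ (- (2 * n)) =
  q ^+ (`|n| ^ 2) * theta n.
Proof.
have -> : 3 * n * (n + 1) = (n * n + 2 * n) * 2 + n * (n - 1) by ring.
rewrite divzMDl // /theta mulrCA -!mulrA; congr (_ * _).
rewrite -expfzDr // exprnP -expfzDr //; congr (_ ^ _).
have -> : (`|n| ^ 2)%N%:Z = n * n by lia.
by ring.
Qed.

(* The limit of the q-Vandermonde sum in which two numerator parameters tend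
   to infinity: multiplying by [1 - q ^ A] lowers [A] and raises [c]. *)
Lemma q_vandermonde A (c : nat) :
  \sum_(m < A.+1) q ^+ (m * (m + c)) *
     (qfactV (A%:Z - m%:Z) * (qfactV m * qfactV (m + c)%N)) = qfactV A * qfactV (A + c)%N.
Proof.
elim: A c => [|A IH] c.
  by rewrite big_ord_recl big_ord0 addr0 mul0n expr0 mul1r subrr add0n !qfactV0 !mul1r.
have qA0 : 1 - q ^+ A.+1 != 0 by rewrite subr_eq0 eq_sym qN1.
apply: (mulfI qA0).
rewrite mulrA -qfactVS.
rewrite addSnnS -IH mulr_sumr.
(* The factor splits as [1 - q^(A+1) = (1 - q^m) + q^m (1 - q^(A+1-m))]. The first part vanishes at
   [m = 0], the second at [m = A + 1], so shifting the first by one leaves two sums over the same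
   range. *)
pose t (m : nat) := q ^+ (m * (m + c)) * (qfactV (A.+1%:Z - m%:Z) * (qfactV m * qfactV (m + c)%N)).
pose d (m : nat) := (1 - q ^+ m) * t m.
pose e (m : nat) := q ^+ m * (1 - q ^ (A.+1%:Z - m%:Z)) * t m.
rewrite (eq_bigr (fun m : 'I_A.+2 => d m + e m)); last first.
  move=> m _; rewrite /d /e /t -mulrDl; congr (_ * _).
  have -> : q ^+ A.+1 = q ^+ m * q ^ (A.+1%:Z - m%:Z).
    by rewrite !exprnP -expfzDr //; congr (_ ^ _); lia.
  ring.
rewrite big_split /= big_ord_recl [X in X + _ + _](_ : _ = 0); last first.
  by rewrite /d expr0 subrr mul0r.
rewrite add0r [X in _ + X]big_ord_recr /= [X in _ + (_ + X)](_ : _ = 0); last first.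
  by rewrite /e subrr expr0z subrr mulr0 mul0r.
rewrite addr0 -big_split /=; apply: eq_bigr => i _.
rewrite /d /e /t /bump /= add1n.
rewrite (qfactVS i) (qfactVS (i + c)).
have -> : A.+1%:Z - i.+1%:Z = A%:Z - i%:Z by lia.
have -> : qfactV (A%:Z - i%:Z) = (1 - q ^ (A.+1%:Z - i%:Z)) * qfactV (A.+1%:Z - i%:Z).
  by rewrite -qfactVB1; congr qfactV; lia.
rewrite addSn addnS.
have -> : (i.+1 * (i + c).+1 = i * (i + c) + i + (i + c).+1)%N by lia.
have -> : (i * (i + c).+1 = i * (i + c) + i)%N by lia.
rewrite !exprD; ring.
Qed.

(** The conjugate Bailey pair. Both sides are even in [r]; for [r = a >= 0] the terms with [n < a]
    vanish, and [n = i + a] turns the rest into [q_vandermonde] with [A = M - a] and [c = 2a]. *)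
Lemma bailey_conjugate (M : nat) (r : int) : (`|r| <= M)%N ->
  \sum_(n < M.+1) q ^+ (n ^ 2) * qfactV (M%:Z - n%:Z) *
     (qfactV (n%:Z - r) * qfactV (n%:Z + r))
  = q ^+ (`|r| ^ 2) * (qfactV (M%:Z - r) * qfactV (M%:Z + r)).
Proof.
wlog [a ->] : r / exists a : nat, r = a.
  move=> W le_rM; have [|r_lt0] := leP 0 r.
    by case: r le_rM => // a le_aM _; apply: W => //; exists a.
  rewrite -(abszN r); have := W (- r).
  rewrite opprK abszN => /(_ _ le_rM) W'.
  rewrite [in RHS]mulrC -[in RHS]mulrA.
  transitivity (q ^+ (`|r| ^ 2) * (qfactV (M%:Z + r) * qfactV (M%:Z - r))); last by ring.
  rewrite -W'; last by exists `|r|%N; lia.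
  by apply: eq_bigr => n _; rewrite [qfactV (_ - r) * _]mulrC.
rewrite absz_nat => le_aM.
pose f n := q ^+ (n ^ 2) * qfactV (M%:Z - n%:Z) * (qfactV (n%:Z - a%:Z) * qfactV (n%:Z + a%:Z)).
rewrite -(big_mkord xpredT f) (big_cat_nat (n := a)) //=; last by rewrite leqW.
rewrite big_nat_cond big1 ?add0r; last first.
  move=> i; rewrite andbT => /andP[_ ia].
  by rewrite /f [qfactV (_ - a%:Z)]qfactV_lt0 ?mul0r ?mulr0 //; lia.
have -> : M.+1 = ((M - a).+1 + a)%N by lia.
rewrite -{1}[a]add0n big_addn addnK big_mkord.
have -> : M%:Z - a%:Z = (M - a)%N by lia.
have -> : M%:Z + a%:Z = (M - a + (a + a))%N by lia.
rewrite -q_vandermonde mulr_sumr; apply: eq_bigr => i _.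
rewrite /f.
have -> : (i + a)%N%:Z - a%:Z = i by lia.
have -> : (i + a)%N%:Z + a%:Z = (i + (a + a))%N by lia.
have -> : M%:Z - (i + a)%N%:Z = (M - a)%N%:Z - i%:Z by lia.
have -> : ((i + a) ^ 2 = a ^ 2 + i * (i + (a + a)))%N by rewrite !expnS !expn0; lia.
rewrite exprD; ring.
Qed.

Hypothesis two_neq0 : (2 : F) != 0.

(** The unit Bailey pair. For [n > 0], reflection gives the sum a second form with an extra [q^r];
    adding the two and multiplying by [1 - q^n] produces a telescoping sum whose boundary terms
    vanish. The doubling is then cancelled by [two_neq0]. *)
Lemma bsum_theta (n L : nat) : (n <= L)%N ->
  bsum L (fun r => theta r * (qfactV (n%:Z - r) * qfactV (n%:Z + r))) = (n == 0)%:R.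
Proof.
case: n => [_|n le_nL].
  rewrite /bsum big1 ?theta0 ?subr0 ?qfactV0 ?mulr1 ?addr0 //.
  by move=> i _; rewrite [qfactV (_ - i.+1%:Z)]qfactV_lt0 ?(mulr0, mul0r) ?addr0.
have qn0 : 1 - q ^+ n.+1 != 0 by rewrite subr_eq0 eq_sym qN1.
set U := bsum _ _.
have UE : U = bsum L (fun r => q ^ r * theta r * (qfactV (n.+1%:Z - r) * qfactV (n.+1%:Z + r))).
  rewrite /U -bsumN; apply: eq_bsum => r.
  by rewrite opprK thetaN [qfactV (_ + r) * _]mulrC.
apply: (mulfI two_neq0); apply: (mulfI qn0).
rewrite !mulr0.
transitivity (bsum L (fun r => theta r * (qfactV (n.+1%:Z - r) * qfactV (n.+1%:Z + r - 1)) -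
    theta (r + 1) * (qfactV (n.+1%:Z - (r + 1)) * qfactV (n.+1%:Z + (r + 1) - 1)))).
  rewrite (_ : 2 * U = U + U); last by ring.
  rewrite {2}UE -bsumD -bsumZ; apply: eq_bsum => r.
  rewrite thetaS qfactVB1 opprD addrA qfactVB1 addrA addrK.
  rewrite expfzDr // expfzDr // -exprnP.
  have := mulfV (expfz_neq0 r q0); rewrite -invr_expz.
  set a := q ^ r => a1.
  transitivity ((1 + a - q ^+ n.+1 * a - a * a^-1 * q ^+ n.+1) * theta r *
                 (qfactV (n.+1%:Z - r) * qfactV (n.+1%:Z + r))); last by ring.
  by rewrite a1; ring.
rewrite (bsum_telescope _ (fun r => theta r * (qfactV (n.+1%:Z - r) * qfactV (n.+1%:Z + r - 1)))).
rewrite [qfactV (_ + - _ - 1)]qfactV_lt0 ?[qfactV (_ - (_ + 1))]qfactV_lt0;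
  by rewrite ?(mulr0, mul0r) ?subrr //; lia.
Qed.

Variable w : F.
Hypotheses (w0 : w != 0) (wq : forall r : int, w * q ^ r != 1).

Definition rank_den (n : nat) : F :=
  \prod_(i < n) ((1 - w * q ^+ i.+1) * (1 - w^-1 * q ^+ i.+1)).

Lemma rank_den0 : rank_den 0 = 1.
Proof. exact: big_ord0. Qed.

Lemma rank_denS n :
  rank_den n.+1 = rank_den n * ((1 - w * q ^+ n.+1) * (1 - w^-1 * q ^+ n.+1)).
Proof. exact: big_ord_recr. Qed.

Let wqB r : 1 - w * q ^ r != 0.
Proof. by rewrite subr_eq0 eq_sym wq. Qed.

Lemma rank_den_neq0 n : rank_den n != 0.
Proof.
apply/prodf_neq0 => i _; apply: mulf_neq0; first by rewrite exprnP wqB.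
rewrite subr_eq0 eq_sym; apply/negP => /eqP e; have /negP := wq (- i.+1%:Z); apply.
rewrite -invr_expz -exprnP; apply/eqP/invr_inj.
by rewrite invfM invrK e invr1.
Qed.

(** By induction on [n]. The product [(1 - w q^(n+1)) (1 - q^(n+1) / w)] differs from
    [(1 - q^(n+1-r)) (1 - q^(n+1+r))] by a multiple of [1 - w q^r]; this cancels the pole and leaves
    sums that vanish by [bsum_theta]. *)
Lemma bsum_theta_pole (n L : nat) : (n <= L)%N ->
  bsum L (fun r => q ^ r * theta r / (1 - w * q ^ r) *
                   (qfactV (n%:Z - r) * qfactV (n%:Z + r))) = ((1 - w) * rank_den n)^-1.
Proof.
elim: n => [_|n IH lt_nL].
  rewrite /bsum big1; last first.
    by move=> i _; rewrite [qfactV (_ - i.+1%:Z)]qfactV_lt0 ?(mulr0, mul0r) ?addr0.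
  by rewrite theta0 subr0 qfactV0 expr0z /rank_den big_ord0 !mulr1 addr0 mul1r.
rewrite /rank_den big_ord_recr /=.
set a := (1 - w * _); set b := (1 - w^-1 * _).
have ab0 : a * b != 0.
  by have := rank_den_neq0 n.+1; rewrite /rank_den big_ord_recr /= mulf_eq0 negb_or => /andP[].
apply: (mulfI ab0); rewrite mulrA invfM mulrC [RHS]mulrC mulfVK // -IH; last exact: ltnW.
rewrite mulrC -bsumZ.
have := bsum_theta lt_nL; rewrite [X in X = _]/= => U0.
transitivity (bsum L (fun r => q ^ r * theta r / (1 - w * q ^ r) *
                   (qfactV (n%:Z - r) * qfactV (n%:Z + r)) +
   (q ^+ n.+1 * (theta (r) * (qfactV (n.+1%:Z - r) * qfactV (n.+1%:Z + r)))
    + (- (q ^+ n.+1 * w^-1)) * (theta (- r) * (qfactV (n.+1%:Z - r) * qfactV (n.+1%:Z + r)))))).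
  apply: eq_bsum => r.
  have -> : qfactV (n%:Z - r) = (1 - q ^ (n.+1%:Z - r)) * qfactV (n.+1%:Z - r).
    by rewrite -qfactVB1; congr qfactV; lia.
  have -> : qfactV (n%:Z + r) = (1 - q ^ (n.+1%:Z + r)) * qfactV (n.+1%:Z + r).
    by rewrite -qfactVB1; congr qfactV; lia.
  rewrite thetaN !expfzDr // -exprnP -invr_expz /a /b.
  have := expfz_neq0 r q0; have := wqB r; set c := q ^ r => c1 c0.
  by field; rewrite w0 c1 c0.
rewrite bsumD bsumD !bsumZ U0.
have -> : bsum L (fun r => theta (- r) * (qfactV (n.+1%:Z - r) * qfactV (n.+1%:Z + r))) = 0.
  rewrite -[RHS]U0 -bsumN; apply: eq_bsum => r.
  by rewrite !opprK [qfactV (_ + r) * _]mulrC.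
by rewrite !mulr0 !addr0.
Qed.

(** As [1 / (1 - w q^r) = 1 + w q^r / (1 - w q^r)], the two previous pairs combine into one with
    weight [theta r / (1 - w q^r)]. Both sides are then the same double sum, which
    [bailey_conjugate] evaluates over [n] first. *)
Theorem finite_rank_identity (M : nat) :
  bsum M (fun r => q ^+ (`|r| ^ 2) * theta r / (1 - w * q ^ r) *
                   (qfactV (M%:Z - r) * qfactV (M%:Z + r)))
  = qfactV M + w / (1 - w) *
      \sum_(n < M.+1) q ^+ (n ^ 2) * qfactV (M%:Z - n%:Z) / rank_den n.
Proof.
transitivity (\sum_(n < M.+1) q ^+ (n ^ 2) * qfactV (M%:Z - n%:Z) *
   ((n == 0 :> nat)%:R + w * ((1 - w) * rank_den n)^-1)); last first.
  under eq_bigr do rewrite mulrDr.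
  rewrite big_split /=; congr (_ + _).
    rewrite big_ord_recl big1 ?addr0; last by move=> i _; rewrite mulr0.
    by rewrite expr0 mul1r mulr1; congr qfactV; lia.
  by rewrite mulr_sumr; apply: eq_bigr => i _; rewrite invfM; ring.
transitivity (\sum_(n < M.+1) bsum M (fun r => theta r / (1 - w * q ^ r) *
   (q ^+ (n ^ 2) * qfactV (M%:Z - n%:Z) * (qfactV (n%:Z - r) * qfactV (n%:Z + r))))).
  rewrite (bsum_exchange M M.+1 (fun n r => theta r / (1 - w * q ^ r) *
   (q ^+ (n ^ 2) * qfactV (M%:Z - n%:Z) * (qfactV (n%:Z - r) * qfactV (n%:Z + r))))).
  have W (r : int) : (`|r| <= M)%N -> q ^+ (`|r| ^ 2) * theta r / (1 - w * q ^ r) *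
      (qfactV (M%:Z - r) * qfactV (M%:Z + r)) = \sum_(i < M.+1) theta r / (1 - w * q ^ r) *
      (q ^+ (i ^ 2) * qfactV (M%:Z - i%:Z) * (qfactV (i%:Z - r) * qfactV (i%:Z + r))).
    by move=> rM; rewrite -mulr_sumr bailey_conjugate //; ring.
  rewrite /bsum W //; congr (_ + _); apply: eq_bigr => i _.
  by rewrite !W //; have := ltn_ord i; lia.
apply: eq_bigr => n _.
rewrite -(bsum_theta (n := n) (L := M)) -?(bsum_theta_pole (n := n) (L := M)); try by rewrite -ltnS.
rewrite -bsumZ -bsumD -bsumZ; apply: eq_bsum => r.
by have := wqB r => c1; field.
Qed.

End FiniteIdentity.

(** The factorisation of [X^k - 1] over the powers of [z], evaluated at [1 / y] and rescaled by
    [y^k]; hence the separate case [y = 0]. *)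
Lemma prod_1BX_root (F : fieldType) (k : nat) (z y : F) : (0 < k)%N ->
  k.-primitive_root z -> \prod_(i < k) (1 - y * z ^+ i) = 1 - y ^+ k.
Proof.
move=> k0 zP; have [->|y0] := eqVneq y 0.
  rewrite expr0n -[k]prednK // subr0 big1 // => i _.
  by rewrite mul0r subr0.
have := congr1 (fun p => p.[y^-1]) (factor_Xn_sub_1 zP).
rewrite big_mkord horner_prod hornerD hornerN hornerC hornerXn => h.
have yk : y ^+ k != 0 by rewrite expf_neq0.
transitivity (y ^+ k * (y^-1 ^+ k - 1)); last first.
  by rewrite mulrBr mulr1 -exprMn mulfV // expr1n.
rewrite -h -[X in y ^+ X](card_ord k) -prodr_const -big_split /=.
apply: eq_bigr => i _.
by rewrite hornerXsubC mulrBr mulfV.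
Qed.

(** * Series of complex numbers *)

Section Modulus.
Variable R : realType.
Local Notation C := (Cplx R).
Implicit Types z : C.

(* The norm of [C] takes its values in [C]; this is the same norm in [R]. *)
Definition cabs z : R := complex.Re `|z|.

Lemma cabsE z : `|z| = ((cabs z)%:C)%C.
Proof. by rewrite /cabs RRe_real // normr_real. Qed.

Lemma cabs_le z (e : R) : (`|z| <= (e%:C)%C) = (cabs z <= e).
Proof. by rewrite cabsE lecR. Qed.

Lemma cabs_real (r : R) : 0 <= r -> cabs ((r%:C)%C : C) = r.
Proof. by move=> r0; apply: complexI; rewrite -cabsE ger0_norm // lecR. Qed.

Lemma cabs_sqr z : cabs z ^+ 2 = complex.Re z ^+ 2 + complex.Im z ^+ 2.
Proof. by apply: complexI; rewrite rmorphXn /= -cabsE -add_Re2_Im2. Qed.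

Lemma cabs_ge0 z : 0 <= cabs z.
Proof. by rewrite -lecR -cabsE normr_ge0. Qed.

Lemma cabs0 : cabs 0 = 0.
Proof. by apply: complexI; rewrite -cabsE normr0. Qed.

Lemma cabs1 : cabs 1 = 1.
Proof. by apply: complexI; rewrite -cabsE normr1. Qed.

Lemma cabsN z : cabs (- z) = cabs z.
Proof. by apply: complexI; rewrite -!cabsE normrN. Qed.

Lemma cabsM z1 z2 : cabs (z1 * z2) = cabs z1 * cabs z2.
Proof. by apply: complexI; rewrite rmorphM /= -!cabsE normrM. Qed.

Lemma cabsV z : cabs z^-1 = (cabs z)^-1.
Proof. by apply: complexI; rewrite fmorphV /= -!cabsE normfV. Qed.

Lemma cabsX z n : cabs (z ^+ n) = cabs z ^+ n.
Proof. by apply: complexI; rewrite rmorphXn /= -!cabsE normrX. Qed.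

Lemma cabs_eq0 z : (cabs z == 0) = (z == 0).
Proof. by rewrite -(inj_eq (@complexI R)) -cabsE normr_eq0. Qed.

Lemma cabs_gt0 z : (0 < cabs z) = (z != 0).
Proof. by rewrite lt_def cabs_eq0 cabs_ge0 andbT. Qed.

Lemma cabsXz z (n : int) : cabs (z ^ n) = cabs z ^ n.
Proof. by case: n => n; rewrite /exprz ?cabsV cabsX. Qed.

Lemma cabs_prod n (f : nat -> C) :
  cabs (\prod_(i < n) f i) = \prod_(i < n) cabs (f i).
Proof.
by elim: n => [|n IH]; rewrite ?big_ord0 ?cabs1 // !big_ord_recr /= cabsM IH.
Qed.

Lemma ler_cabsD z1 z2 : cabs (z1 + z2) <= cabs z1 + cabs z2.
Proof. by rewrite -lecR rmorphD /= -!cabsE ler_normD. Qed.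

Lemma cabsBC z1 z2 : cabs (z1 - z2) = cabs (z2 - z1).
Proof. by rewrite -cabsN opprB. Qed.

Lemma lerB_cabs z1 z2 : cabs z1 - cabs z2 <= cabs (z1 - z2).
Proof. by have := ler_cabsD (z1 - z2) z2; rewrite subrK => ?; lra. Qed.

Lemma ler_cabs_sum m n (f : nat -> C) :
  cabs (\sum_(m <= i < n) f i) <= \sum_(m <= i < n) cabs (f i).
Proof.
elim/big_rec2: _ => [|i y x _ le_xy]; first by rewrite cabs0.
by apply: le_trans (ler_cabsD _ _) _; rewrite lerD2l.
Qed.

Lemma ler_Re_cabs z : `|complex.Re z| <= cabs z.
Proof.
rewrite -ler_sqr ?nnegrE ?normr_ge0 ?cabs_ge0 // real_normK ?num_real // cabs_sqr.
by rewrite lerDl sqr_ge0.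
Qed.

Lemma ler_Im_cabs z : `|complex.Im z| <= cabs z.
Proof.
rewrite -ler_sqr ?nnegrE ?normr_ge0 ?cabs_ge0 // real_normK ?num_real // cabs_sqr.
by rewrite lerDr sqr_ge0.
Qed.

Lemma ler_cabs_ReIm z : cabs z <= `|complex.Re z| + `|complex.Im z|.
Proof.
rewrite -ler_sqr ?nnegrE ?addr_ge0 ?normr_ge0 ?cabs_ge0 // cabs_sqr.
rewrite -(real_normK (num_real (complex.Re z))) -(real_normK (num_real (complex.Im z))).
by have := normr_ge0 (complex.Re z); have := normr_ge0 (complex.Im z); nra.
Qed.

Lemma ReB z1 z2 : complex.Re (z1 - z2) = complex.Re z1 - complex.Re z2.
Proof. by case: z1 z2 => [? ?] [? ?]. Qed.

Lemma ImB z1 z2 : complex.Im (z1 - z2) = complex.Im z1 - complex.Im z2.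
Proof. by case: z1 z2 => [? ?] [? ?]. Qed.

Section Cvg.
Context {T : Type} {F : set_system T} {FF : Filter F}.

Lemma cvg_cabsP (f : T -> C) (l : C) :
  f x @[x --> F] --> l <->
  (forall e : R, 0 < e -> \forall x \near F, cabs (l - f x) <= e).
Proof.
split=> [/cvgrPdist_le H e e0|H].
  have e0' : 0 < (e%:C)%C :> C by rewrite ltcR.
  by apply: filterS (H _ e0') => x; rewrite cabs_le.
apply/cvgrPdist_le => e; rewrite ltcE /= => /andP[/eqP e2 e1].
apply: filterS (H _ e1) => x; rewrite -cabs_le => /le_trans; apply.
by rewrite lecE /= e2 eqxx lexx.
Qed.

Lemma cvg_ReIm (f : T -> C) (l : C) :
  f x @[x --> F] --> l <->
  (complex.Re (f x) @[x --> F] --> complex.Re l /\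
   complex.Im (f x) @[x --> F] --> complex.Im l).
Proof.
split=> [/cvg_cabsP H|[/cvgrPdist_le H1 /cvgrPdist_le H2]].
  split; apply/cvgrPdist_le => e e0; apply: filterS (H _ e0) => x; apply: le_trans.
    by rewrite -ReB ler_Re_cabs.
  by rewrite -ImB ler_Im_cabs.
apply/cvg_cabsP => e e0; have e2 : 0 < e / 2 by lra.
apply: filterS2 (H1 _ e2) (H2 _ e2) => x h1 h2.
by apply: le_trans (ler_cabs_ReIm _) _; rewrite ReB ImB; lra.
Qed.

Lemma cvg_cabs (f : T -> C) (l : C) :
  f x @[x --> F] --> l -> cabs (f x) @[x --> F] --> cabs l.
Proof. by move=> /cvg_norm/cvg_ReIm[]. Qed.

End Cvg.

Lemma series_Re (f : nat -> C) n :
  complex.Re (series f n) = series (fun i => complex.Re (f i)) n.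
Proof.
rewrite /series /=; elim: n => [|n IH]; first by rewrite !big_geq.
by rewrite !big_nat_recr //= -IH; case: (\sum_(_ <= _ < _) _) (f n) => [? ?] [].
Qed.

Lemma series_Im (f : nat -> C) n :
  complex.Im (series f n) = series (fun i => complex.Im (f i)) n.
Proof.
rewrite /series /=; elim: n => [|n IH]; first by rewrite !big_geq.
by rewrite !big_nat_recr //= -IH; case: (\sum_(_ <= _ < _) _) (f n) => [? ?] [].
Qed.

Lemma is_cvg_series_dominated (f : nat -> C) (b : nat -> R) :
  (forall n, cabs (f n) <= b n) -> cvgn (series b) -> cvg (series f @ \oo).
Proof.
move=> fb cb.
have cr (g : nat -> R) : (forall n, `|g n| <= cabs (f n)) -> cvgn (series g).
  move=> gf; apply: normed_cvg; apply: series_le_cvg cb => n //=.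
  - exact: le_trans (normr_ge0 _) (le_trans (gf n) (fb n)).
  - exact: le_trans (gf n) (fb n).
have c1 := cr (fun n => complex.Re (f n)) (fun n => ler_Re_cabs _).
have c2 := cr (fun n => complex.Im (f n)) (fun n => ler_Im_cabs _).
apply/cvg_ex; exists ((limn (series (fun n => complex.Re (f n)))) +i*
   limn (series (fun n => complex.Im (f n))))%C.
apply/cvg_ReIm; split => /=.
  by under eq_fun do rewrite series_Re.
by under eq_fun do rewrite series_Im.
Qed.

(** The bound depends on [b] alone, so it is uniform over all series dominated by [b]; [tannery]
    relies on this. *)
Lemma series_tail_dominated (f : nat -> C) (b : nat -> R) :
  (forall n, cabs (f n) <= b n) -> cvgn (series b) -> forall n,
  cabs (lim (series f @ \oo) - series f n) <= limn (series b) - series b n.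
Proof.
move=> fb cb n; have cf := is_cvg_series_dominated fb cb.
have b0 i : 0 <= b i by apply: le_trans (cabs_ge0 _) (fb i).
apply/ler_addgt0Pr => e e0.
have /cvg_cabsP/(_ e e0) cfe := cf.
near \oo => m.
have le_nm : (n <= m)%N by near: m; exists n.
have h1 : cabs (lim (series f @ \oo) - series f m) <= e by near: m.
have h2 : cabs (series f m - series f n) <= series b m - series b n.
  rewrite /series /= !(big_cat_nat (leq0n n) le_nm) /= !(addrC (\sum_(0 <= i < n) _)) !addrK.
  by apply: le_trans (ler_cabs_sum _ _ _) _; apply: ler_sum.
have h3 : series b m <= limn (series b).
  apply: nondecreasing_cvgn_le => //; apply/nondecreasing_seqP => i.
  by rewrite /series /= big_nat_recr //= lerDl.
have := ler_cabsD (lim (series f @ \oo) - series f m) (series f m - series f n).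
rewrite addrA subrK => h4; lra.
Unshelve. all: by end_near.
Qed.

(** Cut at an [n] where the tail of [b] is at most [e / 3]: both tails are that small, and the
    partial sums converge termwise. The filter is arbitrary since it serves both for [M -> oo] and
    for the radial limit. *)
Lemma tannery {T : Type} {F : set_system T} {FF : ProperFilter F}
    (f : T -> nat -> C) (g : nat -> C) (b : nat -> R) :
  (forall n, f t n @[t --> F] --> g n) ->
  (\forall t \near F, forall n, cabs (f t n) <= b n) ->
  cvgn (series b) ->
  cvg (series g @ \oo) /\
  lim (series (f t) @ \oo) @[t --> F] --> (lim (series g @ \oo) : C).
Proof.
move=> fg fb cb.
have gb n : cabs (g n) <= b n.
  have cg : cabs (f t n) @[t --> F] --> cabs (g n) by apply: cvg_cabs.
  rewrite -(cvg_lim (@norm_hausdorff _ _) cg); apply: limr_le.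
    by apply/cvg_ex; exists (cabs (g n)).
  by apply: filterS fb => t; apply.
split; first exact: is_cvg_series_dominated gb cb.
apply/cvg_cabsP => e e0; have e3 : 0 < e / 3 by lra.
near \oo => n.
have tail : limn (series b) - series b n <= e / 3.
  apply: le_trans (ler_norm _) _; near: n.
  exact: (cvgrPdist_le _ _).1.
have fgn : series (f t) n @[t --> F] --> (series g n : C).
  rewrite /series /=; by apply: cvg_big => //; exact: add_continuous.
have /cvg_cabsP/(_ _ e3) := fgn.
apply: filterS2 fb => t fbt hn.
have h1 := series_tail_dominated fbt cb n.
have h2 := series_tail_dominated gb cb n.
have h3 := ler_cabsD (lim (series g @ \oo) - series g n) (series g n - series (f t) n).
have h4 := ler_cabsD (lim (series g @ \oo) - series (f t) n)
  (series (f t) n - lim (series (f t) @ \oo)).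
move: h3 h4; rewrite addrA subrK addrA subrK => h3 h4.
rewrite (cabsBC (series (f t) n)) in h4.
lra.
Unshelve. all: by end_near.
Qed.

End Modulus.

(** * Limit rules and index shifts for complex series *)

Section Series.
Variable R : realType.
Local Notation C := (Cplx R).

Lemma climP {T : Type} {F : set_system T} {FF : ProperFilter F} (f : T -> C) (l : C) :
  f x @[x --> F] --> l -> lim (f x @[x --> F]) = l.
Proof. by move=> h; apply: cvg_lim h; exact: norm_hausdorff. Qed.

Section CvgRules.
Context {T : Type} {F : set_system T} {FF : Filter F}.

Lemma ccvgM (f g : T -> C) (a b : C) :
  f x @[x --> F] --> a -> g x @[x --> F] --> b -> f x * g x @[x --> F] --> (a * b : C).
Proof.
move=> fa gb.
exact: (cvgM fa gb).
Qed.
Lemma ccvgD (f g : T -> C) (a b : C) :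
  f x @[x --> F] --> a -> g x @[x --> F] --> b -> f x + g x @[x --> F] --> (a + b : C).
Proof.
move=> fa gb.
exact: (cvgD fa gb).
Qed.
Lemma ccvgV (f : T -> C) (a : C) :
  a != 0 -> f x @[x --> F] --> a -> (f x)^-1 @[x --> F] --> (a^-1 : C).
Proof.
move=> fa gb.
exact: (cvgV fa gb).
Qed.
End CvgRules.

Lemma eq_cvg_to {T : Type} {F : set_system T} (f g : T -> C) (l : C) :
  f =1 g -> g x @[x --> F] --> l -> f x @[x --> F] --> l.
Proof. by move=> /funext ->. Qed.

Lemma lim_series_finite (f : nat -> C) N :
  (forall n, (N <= n)%N -> f n = 0) -> lim (series f @ \oo) = series f N.
Proof.
move=> f0; apply: climP; apply: cvg_near_cst; exists N => // n /= le_Nn.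
rewrite /series /= (big_cat_nat (leq0n N) le_Nn) /=.
have -> : \sum_(N <= i < n) f i = 0.
  by rewrite big_nat_cond big1 // => i /andP[/andP[/f0]].
by rewrite addr0.
Qed.

Lemma lim_seriesZ (c : C) (f : nat -> C) : cvg (series f @ \oo) ->
  lim (series (fun n => c * f n) @ \oo) = c * lim (series f @ \oo).
Proof.
move=> cf; apply: climP.
apply: (eq_cvg_to (g := fun n => c * series f n)).
  by move=> n; rewrite /series /= mulr_sumr.
exact: ccvgM (cvg_cst _) cf.
Qed.

Lemma cvg_series_shift (f : nat -> C) k (l : C) :
  series (fun n => f (n + k)%N) @ \oo --> l -> series f @ \oo --> series f k + l.
Proof.
move=> cf; rewrite -(cvg_shiftn k) /=.
apply: (eq_cvg_to (g := fun n => series f k + series (fun n => f (n + k)%N) n)).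
  move=> n; rewrite series_addn /series /=; congr (_ + _).
  by rewrite -{1}[k]add0n big_addn addnK.
exact: ccvgD (cvg_cst _) cf.
Qed.

Lemma lim_series_shift (f : nat -> C) k : cvg (series f @ \oo) ->
  lim (series f @ \oo) = series f k + lim (series (fun n => f (n + k)%N) @ \oo).
Proof.
move=> cf.
have : series (fun n => f (n + k)%N) @ \oo --> lim (series f @ \oo) - series f k.
  apply: (eq_cvg_to (g := fun n => series f (n + k)%N - series f k)).
    move=> n; rewrite series_addn /series /= addrAC subrr add0r.
    by rewrite -{2}[k]add0n big_addn addnK.
  apply: ccvgD; last exact: cvg_cst.
  by have := cf; rewrite -(cvg_shiftn k).
by move=> /climP ->; rewrite addrC subrK.
Qed.

End Series.

(** * The rank identity in the unit disc *)

Section Disc.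
Variables (R : realType) (q : Cplx R).
Local Notation C := (Cplx R).
Hypotheses (q0 : q != 0) (q1 : cabs q < 1).
Local Notation rho := (cabs q).

Let rho_gt0 : 0 < rho. Proof. by rewrite cabs_gt0. Qed.
Let rho1 : 0 < 1 - rho. Proof. by rewrite subr_gt0. Qed.
Let rho_ge0 : 0 <= rho. Proof. exact: ltW. Qed.

Let rhoX n : rho ^+ n <= 1.
Proof. by rewrite exprn_ile1 // ltW. Qed.

Let rhoXS n : rho ^+ n.+1 <= rho.
Proof. by rewrite exprS ler_piMr. Qed.

Lemma qX_neq1 n : q ^+ n.+1 != 1.
Proof.
apply/eqP => /(congr1 (@cabs R)); rewrite cabsX cabs1 => e.
by have := rhoXS n; rewrite e leNgt q1.
Qed.

Lemma geometric_sum_le n : \sum_(i < n) rho ^+ i <= (1 - rho)^-1.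
Proof.
have h : (1 - rho) * (\sum_(i < n) rho ^+ i) = 1 - rho ^+ n.
  by rewrite -opprB mulNr -subrX1 opprB.
rewrite -(ler_pM2l rho1) h mulfV ?gt_eqF //.
by rewrite gerBl exprn_ge0.
Qed.

(** With [y = rho^(n+1)], [1 / (1 - y) = 1 + y / (1 - y) <= exp (y / (1 - y))] and
    [y / (1 - y) <= rho^n / (1 - rho)]. Multiplying over the factors leaves a geometric sum, so the
    bound is independent of their number. *)
Lemma qprod_ge (a : C) n : cabs a <= 1 ->
  expR (- ((1 - rho)^-1 / (1 - rho))) <= cabs (\prod_(i < n) (1 - a * q ^+ i.+1)).
Proof.
move=> a1; rewrite (cabs_prod n (fun i => 1 - a * q ^+ i.+1)).
apply: (@le_trans _ _ (expR (- ((\sum_(i < n) rho ^+ i) / (1 - rho))))).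
  by rewrite ler_expR lerN2 ler_pM2r ?invr_gt0 // geometric_sum_le.
elim: n => [|n IH]; first by rewrite !big_ord0 mul0r oppr0 expR0.
rewrite !big_ord_recr /= mulrDl opprD expRD ler_pM ?expR_ge0 //.
have y1 : rho ^+ n.+1 <= rho ^+ n by rewrite exprS ler_piMl ?exprn_ge0 // ltW.
have y0 : 0 <= rho ^+ n.+1 by rewrite exprn_ge0.
have y2 := rhoXS n.
apply: (@le_trans _ _ (1 - rho ^+ n.+1)); last first.
  apply: le_trans (lerB_cabs _ _); rewrite cabs1 cabsM cabsX lerD2l lerN2.
  by rewrite ler_piMl.
have y3 : 0 < 1 - rho ^+ n.+1 by rewrite subr_gt0; exact: le_lt_trans y2 q1.
rewrite expRN -[leRHS]invrK lef_pV2 ?posrE ?expR_gt0 ?invr_gt0 //.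
apply: le_trans (expR_ge1Dx _).
rewrite -(ler_pM2r y3) mulVf ?gt_eqF //.
have y4 : rho ^+ n.+1 / (1 - rho ^+ n.+1) <= rho ^+ n / (1 - rho).
  by rewrite ler_pM ?invr_ge0 ?(ltW y3) // lef_pV2 ?posrE // lerD2l lerN2.
have y5 : rho ^+ n.+1 / (1 - rho ^+ n.+1) * (1 - rho ^+ n.+1) = rho ^+ n.+1.
  by rewrite divfK ?gt_eqF.
by nra.
Qed.

(** Through [1 + y <= exp y]. This keeps the limit of [qfactV] away from 0. *)
Lemma qprod_le n : cabs (\prod_(i < n) (1 - q ^+ i.+1)) <= expR (1 - rho)^-1.
Proof.
rewrite (cabs_prod n (fun i => 1 - q ^+ i.+1)).
apply: (@le_trans _ _ (expR (\sum_(i < n) rho ^+ i))); last first.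
  by rewrite ler_expR geometric_sum_le.
elim: n => [|n IH]; first by rewrite !big_ord0 expR0.
rewrite !big_ord_recr /= expRD ler_pM ?cabs_ge0 //.
  by rewrite prodr_ge0 // => i _; exact: cabs_ge0.
apply: le_trans (expR_ge1Dx _); apply: le_trans (ler_cabsD _ _) _.
rewrite cabs1 cabsN cabsX lerD2l exprS ler_piMl ?exprn_ge0 //; exact: ltW.
Qed.

Local Notation K := (expR ((1 - rho)^-1 / (1 - rho))).

Lemma qprodV_le (a : C) n : cabs a <= 1 ->
  cabs (\prod_(i < n) (1 - a * q ^+ i.+1))^-1 <= K.
Proof.
move=> a1; rewrite cabsV -[leRHS]invrK -expRN lef_pV2 ?posrE ?expR_gt0 ?qprod_ge //.
exact: lt_le_trans (expR_gt0 _) (qprod_ge _ a1).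
Qed.

Lemma qfactV_le m : cabs (qfactV q m) <= K.
Proof.
case: m => n; last by rewrite /qfactV cabs0 expR_ge0.
rewrite /qfactV; have := @qprodV_le 1 n; rewrite cabs1 lexx => /(_ isT).
by under eq_bigr do rewrite mul1r.
Qed.

Lemma is_cvg_geometricK (c : R) : cvgn (series (fun n => c * rho ^+ n)).
Proof. by apply: (@is_cvg_geometric_series _ c rho); rewrite ger0_norm. Qed.

Arguments is_cvg_geometricK : clear implicits.

Lemma qpochE (a : C) n : qpoch (a * q) q n = \prod_(i < n) (1 - a * q ^+ i.+1).
Proof.
rewrite /qpoch big_add1 big_mkord; apply: eq_bigr => i _.
by rewrite exprS mulrA.
Qed.

(** Consecutive values differ by [q^(n+1) qfactV (n+1)], which is geometrically small, so they
    converge; [qprod_le] keeps their limit [I = 1 / (q)_oo] away from 0. *)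
Lemma qfactV_cvg : exists2 I : C, I != 0 &
  qfactV q (Posz n) @[n --> \oo] --> I /\ qpoch_infty q q = I^-1.
Proof.
pose u (n : nat) : C := qfactV q n.
pose d (n : nat) : C := u n.+1 - u n.
have dS n : series d n = u n - 1.
  rewrite /series /=; elim: n => [|n IH].
    by rewrite big_geq // /u qfactV0 subrr.
  by rewrite big_nat_recr //= IH /d; ring.
have cd : cvg (series d @ \oo).
  apply: (is_cvg_series_dominated _ (is_cvg_geometricK K)) => n.
  rewrite /d /u (qfactVS q0 qX_neq1 n) mulrBl mul1r opprB addrC subrK cabsM cabsX mulrC.
  apply: ler_pM; rewrite ?cabs_ge0 ?exprn_ge0 ?qfactV_le //.
  by rewrite exprS ler_piMl ?exprn_ge0 // ltW.
have cu : u n @[n --> \oo] --> lim (series d @ \oo) + 1.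
  apply: (eq_cvg_to (g := fun n => series d n + 1)).
    by move=> n; rewrite dS subrK.
  exact: ccvgD cd (cvg_cst _).
have I0 : lim (series d @ \oo) + 1 != 0.
  rewrite -cabs_gt0; apply: lt_le_trans (expR_gt0 (- (1 - rho)^-1)) _.
  have ccu : cabs (u n) @[n --> \oo] --> cabs (lim (series d @ \oo) + 1) by apply: cvg_cabs.
  rewrite -(cvg_lim (@norm_hausdorff _ _) ccu).
  apply: limr_ge; first by apply/cvg_ex; exists (cabs (lim (series d @ \oo) + 1)).
  apply: nearW => n; rewrite /u /qfactV cabsV expRN lef_pV2 ?posrE ?expR_gt0 ?qprod_le //.
  rewrite cabs_gt0; apply/prodf_neq0 => i _; by rewrite subr_eq0 eq_sym qX_neq1.
exists (lim (series d @ \oo) + 1) => //; split => //.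
apply: climP.
apply: (eq_cvg_to (g := fun n => (u n)^-1)).
  move=> n; rewrite /u /qfactV invrK -{1}[q]mul1r qpochE.
  by under eq_bigr do rewrite mul1r.
exact: ccvgV I0 cu.
Qed.

Lemma qfactV_cvg_shift (I : C) (r : int) : qfactV q (Posz n) @[n --> \oo] --> I ->
  qfactV q (n%:Z + r) @[n --> \oo] --> I.
Proof.
move=> cI; case: r => k.
  by have := cI; rewrite -(cvg_shiftn k).
rewrite -(cvg_shiftn k.+1) /=.
by apply: eq_cvg_to cI => n; congr qfactV; lia.
Qed.

Variable w : C.
Hypotheses (w1 : cabs w = 1) (wN1 : w != 1).

Let w0 : w != 0. Proof. by rewrite -cabs_gt0 w1 ltr01. Qed.

(** The summand of [appell3] at [v = - 2 tau] with [w = exp (2 pi i u)], rewritten by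
    [appell3_exponent]. *)
Definition appell_term (r : int) : C := q ^+ (`|r| ^ 2) * theta q r / (1 - w * q ^ r).

(** For [r > 0], [|w q^r| <= rho]; for [r < 0], [|w q^r| >= 1 / rho], and [1 / rho - 1] exceeds
    [1 - rho] by [(1 - rho)^2 / rho]. *)
Lemma appell_den_ge (r : int) : r != 0 -> 1 - rho <= cabs (1 - w * q ^ r).
Proof.
case: r => [[|n]|n] // _.
  apply: le_trans (lerB_cabs _ _); rewrite cabs1 cabsM w1 mul1r cabsXz.
  by rewrite lerD2l lerN2 rhoXS.
rewrite cabsBC; apply: le_trans (lerB_cabs _ _); rewrite cabs1 cabsM w1 mul1r cabsXz.
rewrite NegzE -invr_expz -exprnP.
have h1 := rhoXS n; have h2 : 0 < rho ^+ n.+1 by rewrite exprn_gt0.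
have h3 : rho^-1 <= (rho ^+ n.+1)^-1 by rewrite lef_pV2 ?posrE.
have h4 : rho^-1 - 1 - (1 - rho) = rho^-1 * (1 - rho) ^+ 2 by field; rewrite gt_eqF.
rewrite -subr_ge0 in h3; rewrite -subr_ge0.
rewrite [leRHS](_ : _ = ((rho ^+ n.+1)^-1 - rho^-1) + (rho^-1 - 1 - (1 - rho))); last by ring.
by rewrite h4 addr_ge0 // mulr_ge0 ?invr_ge0 ?sqr_ge0.
Qed.

Lemma w_neq1 (r : int) : w * q ^ r != 1.
Proof.
have [->|r0] := eqVneq r 0; first by rewrite expr0z mulr1.
have := appell_den_ge r0; apply: contraTneq => ->.
by rewrite subrr cabs0 -ltNge.
Qed.

Lemma theta_le r : cabs (theta q r) <= 1.
Proof.
rewrite /theta cabsM !cabsXz cabsN cabs1 exp1rz mul1r.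
have : 0 <= ((r * (r - 1)) %/ 2)%Z by rewrite divz_ge0 //; nia.
by case: (_ %/ _)%Z => // n _; exact: rhoX.
Qed.

Lemma appell_term_le (n : nat) (r : int) : `|r|%N = n.+1 ->
  cabs (appell_term r) <= rho ^+ n / (1 - rho).
Proof.
move=> rn; rewrite /appell_term rn cabsM cabsV.
have h := appell_den_ge (_ : r != 0); have r0 : r != 0 by lia.
apply: ler_pM; rewrite ?cabs_ge0 ?invr_ge0 ?cabs_ge0 //.
  rewrite cabsM cabsX -[leRHS]mulr1; apply: ler_pM; rewrite ?exprn_ge0 ?cabs_ge0 ?theta_le //.
  by apply: ler_wiXn2l => //; [exact: ltW|rewrite !expnS expn0; nia].
by rewrite lef_pV2 ?posrE ?h //; apply: lt_le_trans (h r0).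
Qed.

Lemma rank_term_rank_den n : rank_term w q n = q ^+ (n ^ 2) / rank_den q w n.
Proof. by rewrite /rank_term !qpochE /rank_den big_split. Qed.

Lemma rank_denV_le n : cabs (rank_den q w n)^-1 <= K * K.
Proof.
rewrite /rank_den big_split /= invfM cabsM; apply: ler_pM; rewrite ?cabs_ge0 //.
  by apply: qprodV_le; rewrite w1.
by apply: qprodV_le; rewrite cabsV w1 invr1.
Qed.

Lemma qXsq_le n : cabs (q ^+ (n ^ 2)) <= rho ^+ n.
Proof.
rewrite cabsX; apply: ler_wiXn2l => //; first exact: ltW.
by rewrite !expnS expn0; nia.
Qed.

(** As [M -> oo] in [finite_rank_identity] every [qfactV] tends to [I = 1 / (q)_oo]: the left side
    tends to [I^2] times the Appell sum, the right side to [I] times the claimed value, and one [I]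
    cancels. *)
Theorem appell_rank_disc :
  (qpoch_infty q q)^-1 * sum_int appell_term = w / (1 - w) * rank_gen w q + 1.
Proof.
have [I I0 [cI ->]] := qfactV_cvg; rewrite invrK.
have K0 : 0 <= K by exact: expR_ge0.
have two0 : (2 : C) != 0 by rewrite pnatr_eq0.
have Iz r := qfactV_cvg_shift r cI.
pose f (M n : nat) : C := q ^+ (n ^ 2) * qfactV q (M%:Z - n%:Z) / rank_den q w n.
have [cf limf] : cvg (series (fun n => I * rank_term w q n) @ \oo) /\
    lim (series (f M) @ \oo) @[M --> \oo] -->
    (lim (series (fun n => I * rank_term w q n) @ \oo) : C).
  apply: (tannery (b := fun n => K * (K * K) * rho ^+ n)).
  - move=> n; rewrite rank_term_rank_den mulrCA mulrA.
    exact: ccvgM (ccvgM (cvg_cst _) (Iz _)) (cvg_cst _).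
  - apply: nearW => M n; rewrite /f !cabsM mulrC -mulrA mulrC -!mulrA.
    rewrite mulrC -!mulrA.
    have := qXsq_le n; have := qfactV_le (M%:Z - n%:Z); have := rank_denV_le n.
    move=> h1 h2 h3.
    rewrite [leRHS](_ : _ = rho ^+ n * (K * (K * K))); last by ring.
    rewrite [leLHS](_ : _ = cabs (q ^+ (n ^ 2)) *
      (cabs (qfactV q (M%:Z - n%:Z)) * cabs (rank_den q w n)^-1)); last by ring.
    by rewrite !ler_pM ?mulr_ge0 ?cabs_ge0.
  - exact: is_cvg_geometricK.
pose h (M i : nat) : C := appell_term i.+1 * (qfactV q (M%:Z - i.+1%:Z) * qfactV q (M%:Z + i.+1%:Z))
   + appell_term (- i.+1%:Z) * (qfactV q (M%:Z + i.+1%:Z) * qfactV q (M%:Z - i.+1%:Z)).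
pose up (n : nat) : C := appell_term n.+1.
pose down (n : nat) : C := appell_term (- n.+1%:Z).
pose a (i : nat) : C := I * I * (up i + down i).
have [ca lima] : cvg (series a @ \oo) /\
    lim (series (h M) @ \oo) @[M --> \oo] --> (lim (series a @ \oo) : C).
  apply: (tannery (b := fun n => (2 * (K * K) / (1 - rho)) * rho ^+ n)).
  - move=> n; rewrite /a mulrDr.
    apply: ccvgD; rewrite mulrC.
      exact: ccvgM (cvg_cst _) (ccvgM (Iz _) (Iz _)).
    exact: ccvgM (cvg_cst _) (ccvgM (Iz _) (Iz _)).
  - apply: nearW => M n; rewrite /h; apply: le_trans (ler_cabsD _ _) _.
    rewrite (cabsM (appell_term n.+1)) (cabsM (appell_term (- n.+1%:Z))) !(cabsM (qfactV _ _)).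
    have h1 : cabs (appell_term n.+1) <= rho ^+ n / (1 - rho) by apply: appell_term_le.
    have h2 : cabs (appell_term (- n.+1%:Z)) <= rho ^+ n / (1 - rho) by apply: appell_term_le.
    have h3 := qfactV_le (M%:Z - n.+1%:Z); have h4 := qfactV_le (M%:Z + n.+1%:Z).
    rewrite [leRHS](_ : _ = rho ^+ n / (1 - rho) * (K * K) +
      rho ^+ n / (1 - rho) * (K * K)); last by ring.
    by apply: lerD; (apply: ler_pM; rewrite ?mulr_ge0 ?cabs_ge0 //;
      apply: ler_pM; rewrite ?cabs_ge0).
  - exact: is_cvg_geometricK.
have cA (s : nat -> int) : (forall n, `|s n|%N = n.+1) ->
    cvg (series (fun n => appell_term (s n)) @ \oo).
  move=> sn; apply: (is_cvg_series_dominated _ (is_cvg_geometricK (1 - rho)^-1)) => n.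
  by rewrite mulrC; apply: appell_term_le.
have c1 : cvg (series up @ \oo) by apply: cA.
have c2 : cvg (series down @ \oo) by apply: cA.
have key : appell_term 0 * (I * I) + lim (series a @ \oo) =
    I + w / (1 - w) * lim (series (fun n => I * rank_term w q n) @ \oo).
  pose g (M : nat) := appell_term 0 * (qfactV q (M%:Z + 0) * qfactV q (M%:Z + 0)) +
    lim (series (h M) @ \oo).
  apply: (@cvg_unique _ (@norm_hausdorff _ C) (g @ \oo)).
    exact: ccvgD (ccvgM (cvg_cst _) (ccvgM (Iz _) (Iz _))) lima.
  apply: (eq_cvg_to (g := fun M : nat => qfactV q M + w / (1 - w) * lim (series (f M) @ \oo))).
    move=> M.
    (* Beyond the cutoff [M] one [qfactV] has a negative argument, so the full series are the finite
       sums of the identity. *)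
    rewrite (@lim_series_finite _ (f M) M.+1); last first.
      move=> n ltMn; have neg : M%:Z - n%:Z < 0 by clear -ltMn; lia.
      by rewrite /f (qfactV_lt0 _ neg) mulr0 mul0r.
    rewrite (@lim_series_finite _ (h M) M); last first.
      move=> n leMn; have neg : M%:Z - n.+1%:Z < 0 by clear -leMn; lia.
      by rewrite /h (qfactV_lt0 _ neg) mul0r !mulr0 addr0.
    have := finite_rank_identity q0 qX_neq1 two0 w0 w_neq1 M.
    rewrite /series /= !big_mkord => <-.
    by rewrite /bsum; congr (_ + _).
  exact: ccvgD cI (ccvgM (cvg_cst _) limf).
have limA : lim (series (fun n => a n) @ \oo) = I * I *
    (lim (series up @ \oo) + lim (series down @ \oo)).
  rewrite (@lim_seriesZ _ (I * I) (fun n => up n + down n)); last first.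
    apply: (is_cvg_series_dominated _ (is_cvg_geometricK (2 / (1 - rho)))) => n.
    have h1 : cabs (appell_term n.+1) <= rho ^+ n / (1 - rho) by apply: appell_term_le.
    have h2 : cabs (appell_term (- n.+1%:Z)) <= rho ^+ n / (1 - rho) by apply: appell_term_le.
    apply: le_trans (ler_cabsD _ _) _.
    rewrite [leRHS](_ : _ = rho ^+ n / (1 - rho) + rho ^+ n / (1 - rho)); last by ring.
    exact: lerD.
  congr (_ * _); apply: climP.
  apply: (eq_cvg_to (g := fun n => series up n + series down n)).
    by move=> n; rewrite /series /= big_split.
  exact: ccvgD c1 c2.
have sumA : sum_int appell_term = appell_term 0 +
    (lim (series up @ \oo) + lim (series down @ \oo)).
  (* The nonnegative half of [sum_int] starts at index 0, while [up] starts at 1. *)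
  rewrite /sum_int addrA; congr (_ + _); apply: climP.
  have -> : appell_term 0 = series (fun n : nat => appell_term n) 1.
    by rewrite /series /= big_nat1.
  apply: cvg_series_shift; under eq_fun do rewrite addn1; exact: c1.
have cr : cvg (series (rank_term w q) @ \oo).
  apply: (is_cvg_series_dominated _ (is_cvg_geometricK (K * K))) => n.
  rewrite rank_term_rank_den cabsM mulrC.
  by apply: ler_pM; rewrite ?cabs_ge0 ?rank_denV_le ?qXsq_le.
move: key; rewrite limA lim_seriesZ // -/(rank_gen w q) sumA => key.
apply: (mulfI I0).
rewrite [RHS]mulrDr mulr1 [RHS]addrC [I * (w / _ * _)]mulrCA -key; ring.
Qed.

End Disc.

(** * Radial limits at roots of unity *)

Section RootOfUnity.
Variables (R : realType) (k : nat) (zeta x : Cplx R).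
Local Notation C := (Cplx R).
Hypotheses (k0 : (0 < k)%N) (zetaP : k.-primitive_root zeta).
Hypotheses (x1 : cabs x = 1) (xk : complex.Re (x ^+ k) < 1 / 2).

(** Bernoulli's inequality, used both near [rho = 1] and to choose a geometric ratio. *)
Lemma one_sub_expr_le (s : R) n : 0 <= s <= 1 -> 1 - s ^+ n <= n%:R * (1 - s).
Proof.
move=> /andP[s0 s1].
elim: n => [|n IH]; first by rewrite expr0 subrr mul0r.
rewrite exprS -natr1.
have h : 0 <= s ^+ n <= 1 by rewrite exprn_ge0 //= exprn_ile1.
move: h IH; set a := s ^+ n; set b := n%:R => /andP[h1 h2] IH.
nra.
Qed.

(** Replace the factors one at a time; each exchange costs at most [e B^(n-1)], and [1 <= B] allows
    the cruder [B^n]. *)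
Lemma prod_perturb (B e : R) (a b : nat -> C) n : 1 <= B -> 0 <= e ->
  (forall i, (i < n)%N -> [/\ cabs (a i) <= B, cabs (b i) <= B & cabs (a i - b i) <= e]) ->
  cabs (\prod_(i < n) a i - \prod_(i < n) b i) <= n%:R * B ^+ n * e.
Proof.
move=> B1 e0; elim: n => [|n IH] H; first by rewrite !big_ord0 subrr cabs0 !mul0r.
have {IH} IH := IH (fun i lt_in => H i (ltnW lt_in)).
have Bn : 1 <= B ^+ n by rewrite exprn_ege1.
have hb : cabs (\prod_(i < n) b i) <= B ^+ n.
  rewrite (cabs_prod n b) -[X in _ <= _ ^+ X](card_ord n) -prodr_const.
  apply: ler_prod => i _; rewrite cabs_ge0 /=.
  by have [] := H i (leqW (ltn_ord i)).
have [h1 h2 h3] := H n (ltnSn n).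
rewrite !big_ord_recr /=; move: IH hb; set P := \prod_(i < n) a i; set Q := \prod_(i < n) b i.
move=> IH hb.
rewrite (_ : P * a n - Q * b n = a n * (P - Q) + (a n - b n) * Q); last by ring.
apply: le_trans (ler_cabsD _ _) _; rewrite !cabsM.
have g1 : cabs (a n) * cabs (P - Q) <= B * (n%:R * B ^+ n * e) by apply: ler_pM; rewrite ?cabs_ge0.
have g2 : cabs (a n - b n) * cabs Q <= e * B ^+ n by apply: ler_pM; rewrite ?cabs_ge0.
have g3 : e * B ^+ n <= B * (e * B ^+ n) by rewrite ler_peMl // mulr_ge0 // (le_trans _ Bn).
rewrite -natr1 exprS.
rewrite [leRHS](_ : _ = B * (n%:R * B ^+ n * e) + B * (e * B ^+ n)); last by ring.
lra.
Qed.

Let zeta1 : cabs zeta = 1.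
Proof.
have := congr1 (@cabs R) (prim_expr_order zetaP); rewrite cabsX cabs1 => /eqP.
by rewrite pexpr_eq1 // ?cabs_ge0 // => /eqP.
Qed.

Let x0 : x != 0. Proof. by rewrite -cabs_gt0 x1 ltr01. Qed.

Lemma xk_neq1 : x ^+ k != 1.
Proof. by apply/eqP => e; move: xk; rewrite e /=; lra. Qed.

(** For [z = x^k] on the unit circle, [1 - Y / z = (z - Y) / z] and [|z - Y| = |1 - z Y|], so the
    product has modulus [|1 - z Y|^2]. *)
Lemma cabs_block_center (Y : R) : 0 <= Y ->
  cabs ((1 - x ^+ k * (Y%:C)%C) * (1 - x ^- k * (Y%:C)%C))
  = 1 - 2 * complex.Re (x ^+ k) * Y + Y ^+ 2.
Proof.
move=> Y0.
have z1 : cabs (x ^+ k) = 1 by rewrite cabsX x1 expr1n.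
have z0 : x ^+ k != 0 by rewrite expf_neq0.
have e1 : 1 - x ^- k * (Y%:C)%C = (x ^+ k)^-1 * (x ^+ k - (Y%:C)%C).
  by rewrite mulrBr mulVf.
have := cabs_sqr (x ^+ k); rewrite z1 expr1n.
set z := x ^+ k in e1 z1 *.
rewrite cabsM e1 cabsM cabsV z1 invr1 mul1r => zz.
set S := RHS.
have h1 : cabs (1 - z * (Y%:C)%C) ^+ 2 = S.
  rewrite cabs_sqr /S; case: (z) zz => a b /= zz.
  transitivity (1 - 2 * a * Y + (a ^+ 2 + b ^+ 2) * Y ^+ 2); first by ring.
  by rewrite -zz mul1r.
have h2 : cabs (z - (Y%:C)%C) ^+ 2 = S.
  rewrite cabs_sqr /S; case: (z) zz => a b /= zz.
  transitivity (a ^+ 2 + b ^+ 2 - 2 * a * Y + Y ^+ 2); first by ring.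
  by rewrite -zz.
have -> : cabs (z - (Y%:C)%C) = cabs (1 - z * (Y%:C)%C).
  by apply/eqP; rewrite -(@eqrXn2 _ 2) ?cabs_ge0 // h1 h2.
by rewrite -h1 expr2.
Qed.

Lemma rank_term_shift (q : C) m :
  rank_term x q (m + k) = rank_term x q m * q ^+ (2 * m * k + k ^ 2) /
    \prod_(i < k) ((1 - x * q ^+ (m + i).+1) * (1 - x^-1 * q ^+ (m + i).+1)).
Proof.
rewrite !rank_term_rank_den /rank_den big_split_ord /= invfM.
have -> : ((m + k) ^ 2 = m ^ 2 + (2 * m * k + k ^ 2))%N by rewrite !expnS !expn0; lia.
by rewrite exprD; ring.
Qed.

(** The exponents [m + 1, ..., m + k] run through all residues modulo [k], so [prod_1BX_root]
    applies to both families. The modulus is frozen at [rm] across the block. *)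
Lemma block_center m (Y : R) (rm : R) : rm ^+ k = Y ->
  \prod_(i < k) ((1 - x * (rm%:C)%C * zeta ^+ (m + i).+1) *
                 (1 - x^-1 * (rm%:C)%C * zeta ^+ (m + i).+1)) =
  (1 - x ^+ k * (Y%:C)%C) * (1 - x ^- k * (Y%:C)%C).
Proof.
move=> eY; rewrite big_split /=.
have h (y : C) : \prod_(i < k) (1 - y * (rm%:C)%C * zeta ^+ (m + i).+1) = 1 - y ^+ k * (Y%:C)%C.
  rewrite (eq_bigr (fun i : 'I_k => 1 - y * (rm%:C)%C * zeta ^+ m.+1 * zeta ^+ i)); last first.
    by move=> i _; rewrite -addSn exprD !mulrA.
  rewrite (prod_1BX_root _ k0 zetaP) !exprMn -[(zeta ^+ _) ^+ _]exprM
     [(_ * k)%N]mulnC exprM (prim_expr_order zetaP).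
  by rewrite expr1n mulr1 -rmorphXn /= eY.
by rewrite !h exprVn.
Qed.

(** Both [r] and [rho0] are fixed before [rho] and [m]: this uniformity yields one dominating series
    for the whole radial approach. *)
Lemma rank_term_contract : exists r : R, [/\ 0 < r, r < 1 &
  exists2 rho0 : R, 0 < rho0 < 1 & forall rho, rho0 <= rho <= 1 -> forall m,
  cabs (rank_term x ((rho%:C)%C * zeta) (m + k)) <=
  r * cabs (rank_term x ((rho%:C)%C * zeta) m)].
Proof.
have [c ec xkc] : exists2 c, c = complex.Re (x ^+ k) & c < 1 / 2 by exists (complex.Re (x ^+ k)).
(* The two upper bounds on [d] are those that make [m1] and [m2] below nonnegative. *)
have [d [d0 d1 dc]] : exists d : R, [/\ 0 < d, d <= 1 / 2 & d <= (1 - 2 * c) / 2].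
  have [c0|c0] := leP c 0; first by exists (1 / 2); split; lra.
  by exists ((1 - 2 * c) / 2); split; lra.
exists (1 + d)^-1; split; first by rewrite invr_gt0; lra.
  by rewrite invf_lt1; lra.
(* [L] collects the perturbation constants, so that [1 - rho <= d / L] keeps the error at most [d]:
   factors are bounded by [4 = 2 * 2], their differences by [4 * e], and [e <= k (1 - rho)]. *)
set L := k%:R * 4 ^+ k * 4 * k%:R : R.
have kR : 1 <= k%:R :> R by rewrite ler1n.
have L1 : 1 <= L.
  have h4 : 1 <= 4 ^+ k :> R by rewrite exprn_ege1 //; lra.
  by rewrite /L !mulr_ege1 //; lra.
exists (1 - d / L).
  have : 0 < d / L by rewrite divr_gt0 //; lra.
  have : d / L <= d by rewrite ler_pdivrMr ?ler_peMr //; lra.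
  by move=> *; apply/andP; split; lra.
move=> rho /andP[rho_ge rho1] m.
have dL : d / L <= 1 / 2.
  have : d / L <= d by rewrite ler_pdivrMr ?ler_peMr //; lra.
  lra.
have rho_gt0 : 0 < rho by lra.
set q := (rho%:C)%C * zeta.
have q1 : cabs q = rho by rewrite cabsM zeta1 mulr1 cabs_real // ltW.
set Y := (rho ^+ m) ^+ k.
have rmX n : 0 < rho ^+ n <= 1 by rewrite exprn_gt0 //= exprn_ile1 // ltW.
have Y0 : 0 < Y <= 1 by rewrite /Y -exprM.
have qX n : q ^+ n = ((rho ^+ n)%:C)%C * zeta ^+ n by rewrite exprMn rmorphXn.
have Hz n : cabs (zeta ^+ n) = 1 by rewrite cabsX zeta1 expr1n.
pose a i := (1 - x * q ^+ (m + i).+1) * (1 - x^-1 * q ^+ (m + i).+1).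
pose b i := (1 - x * ((rho ^+ m)%:C)%C * zeta ^+ (m + i).+1) *
            (1 - x^-1 * ((rho ^+ m)%:C)%C * zeta ^+ (m + i).+1).
(* Freezing the modulus at [rho^m] within a block of [k] factors changes each power of [rho] by at
   most [1 - rho^k]. *)
set e := 1 - rho ^+ k.
have e0 : 0 <= e by rewrite subr_ge0; have /andP[] := rmX k.
have small (s : R) : 0 <= s <= 1 -> forall y n, cabs y = 1 ->
    cabs (1 - y * ((s%:C)%C * zeta ^+ n)) <= 2.
  move=> /andP[s0 s1] y n y1; apply: le_trans (ler_cabsD _ _) _.
  by rewrite cabsN cabs1 !cabsM y1 Hz cabs_real // mul1r mulr1; lra.
have close (y : C) i : cabs y = 1 -> (i < k)%N ->
    cabs ((1 - y * (((rho ^+ (m + i).+1)%:C)%C * zeta ^+ (m + i).+1)) -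
          (1 - y * (((rho ^+ m)%:C)%C * zeta ^+ (m + i).+1))) <= e.
  move=> y1 lt_ik.
  rewrite (_ : _ - _ = y * zeta ^+ (m + i).+1 *
    (((rho ^+ m)%:C)%C - ((rho ^+ (m + i).+1)%:C)%C)); last by ring.
  rewrite !cabsM y1 Hz !mul1r -rmorphB /= -addnS exprD.
  have /andP[u1 u2] := rmX m; have /andP[v1 v2] := rmX i.+1.
  have v3 : rho ^+ k <= rho ^+ i.+1 by apply: ler_wiXn2l => //; exact: ltW.
  have /andP[w1 w2] := rmX k.
  rewrite cabs_real; rewrite /e; nra.
have xV1 : cabs x^-1 = 1 by rewrite cabsV x1 invr1.
have rm01 n : 0 <= rho ^+ n <= 1 by have /andP[? ->] := rmX n; rewrite ltW.
have pert : cabs (\prod_(i < k) a i - \prod_(i < k) b i) <= k%:R * 4 ^+ k * (4 * e).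
  apply: prod_perturb; [lra|lra|] => i lt_ik.
  rewrite /a /b qX -!(mulrA _ _ (zeta ^+ _)).
  have s1 := small _ (rm01 (m + i).+1) _ (m + i).+1 x1.
  have s2 := small _ (rm01 (m + i).+1) _ (m + i).+1 xV1.
  have s3 := small _ (rm01 m) _ (m + i).+1 x1.
  have s4 := small _ (rm01 m) _ (m + i).+1 xV1.
  have s5 := close _ _ x1 lt_ik.
  have s6 := close _ _ xV1 lt_ik.
  move: s1 s2 s3 s4 s5 s6.
  set a1 := 1 - _; set a2 := 1 - _; set b1 := 1 - _; set b2 := 1 - _ => s1 s2 s3 s4 s5 s6.
  have mul22 (z1 z2 : C) u v : cabs z1 <= u -> cabs z2 <= v -> cabs (z1 * z2) <= u * v.
    by move=> ? ?; rewrite cabsM ler_pM ?cabs_ge0.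
  split.
  - by have := mul22 _ _ _ _ s1 s2; lra.
  - by have := mul22 _ _ _ _ s3 s4; lra.
  - rewrite (_ : a1 * a2 - b1 * b2 = (a1 - b1) * a2 + b1 * (a2 - b2)); last by ring.
    apply: le_trans (ler_cabsD _ _) _.
    by have := mul22 _ _ _ _ s5 s2; have := mul22 _ _ _ _ s3 s6; lra.
have err : k%:R * 4 ^+ k * (4 * e) <= d.
  have : e <= k%:R * (1 - rho) by apply: one_sub_expr_le; rewrite ltW.
  have e1 : k%:R * (1 - rho) <= k%:R * (d / L) by rewrite ler_wpM2l ?ler0n //; lra.
  have e2 : k%:R * 4 ^+ k * 4 * (k%:R * (d / L)) = d.
    rewrite mulrA -/L mulrC divfK // gt_eqF //; lra.
  move=> e3; rewrite -e2 mulrA; apply: ler_wpM2l; last exact: le_trans e3 e1.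
  by rewrite !mulr_ge0 ?ler0n ?exprn_ge0.
have center := @block_center m Y (rho ^+ m) erefl.
have Yge0 : 0 <= Y by have /andP[/ltW] := Y0.
have center_abs := cabs_block_center Yge0.
rewrite -center -ec in center_abs.
have blk : (1 + d) * Y ^+ 2 <= cabs (\prod_(i < k) a i).
  have h1 := lerB_cabs (\prod_(i < k) b i) (\prod_(i < k) a i).
  rewrite cabsBC in pert.
  (* The spare [d] absorbs the perturbation error; the difference of the two sides is exactly
     [m1 + m2 + m3]. *)
  have h2 : (1 + d) * Y ^+ 2 + d <= cabs (\prod_(i < k) b i).
    rewrite center_abs; case/andP: Y0 => Ya Yb.
    have m1 : 0 <= (1 - Y) * (1 - 2 * d) by apply: mulr_ge0; lra.
    have m2 : 0 <= Y * (1 - 2 * c - 2 * d) by apply: mulr_ge0; lra.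
    have m3 : 0 <= d * (1 - Y ^+ 2)
      by apply: mulr_ge0; [exact: ltW|rewrite subr_ge0 exprn_ile1 // ltW].
    lra.
  lra.
rewrite rank_term_shift -/q cabsM cabsM cabsV -mulrA mulrC.
apply: ler_wpM2r; first exact: cabs_ge0.
have Y2 : 0 < Y ^+ 2 by rewrite exprn_gt0 //; case/andP: Y0.
rewrite ler_pdivrMr; last first.
  by apply: lt_le_trans blk; rewrite mulr_gt0 //; lra.
rewrite cabsX q1.
(* The numerator has modulus [rho^(2mk + k^2)], at most [rho^(2mk) = Y^2]. *)
apply: (@le_trans _ _ (Y ^+ 2)).
  rewrite /Y -!exprM; apply: ler_wiXn2l => //; first exact: ltW.
  by clear; nia.
rewrite -(ler_pM2l (_ : 0 < 1 + d)); last by lra.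
by rewrite mulVKf // gt_eqF //; lra.
Qed.

(** Contraction by [r] every [k] steps becomes decay by [s] at each step. Neither [s] nor [B']
    depends on the sequence [a], so one bound serves every [rho]. *)
Lemma geometric_domination (r : R) : 0 < r < 1 ->
  exists2 s : R, 0 < s < 1 & forall (B : R), 0 <= B -> exists B' : R,
  forall a : nat -> R, (forall m, a (m + k)%N <= r * a m) ->
  (forall m, (m < k)%N -> a m <= B) -> forall n, a n <= B' * s ^+ n.
Proof.
move=> /andP[r0 r1].
have kR : 1 <= k%:R :> R by rewrite ler1n.
(* For this choice Bernoulli's inequality gives [s^k >= r]. *)
pose s := 1 - (1 - r) / k%:R.
have s1 : (1 - r) / k%:R <= 1 - r.
  by rewrite ler_pdivrMr ?ler_peMr //; lra.
have s2 : 0 < (1 - r) / k%:R by rewrite divr_gt0 //; lra.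
have s01 : 0 < s < 1 by rewrite /s; apply/andP; split; lra.
case/andP: (s01) => s0 sl1.
have sk : r <= s ^+ k.
  have s01' : 0 <= s <= 1 by rewrite (ltW s0) (ltW sl1).
  have := one_sub_expr_le k s01'.
  rewrite {2}/s opprB addrCA subrr addr0 mulrC divfK; last by rewrite gt_eqF //; lra.
  lra.
(* Dividing by [s^k] covers the first block, where [s^n >= s^k]. *)
exists s => // B B0; exists (B / s ^+ k) => a arec abnd.
elim/ltn_ind => n IH.
have skp : 0 < s ^+ k by rewrite exprn_gt0.
have [lt_nk|le_kn] := ltnP n k.
  apply: le_trans (abnd _ lt_nk) _; rewrite -mulrA ler_peMr // mulrC.
  rewrite ler_pdivlMr // mul1r; apply: ler_wiXn2l; [exact: ltW|exact: ltW|exact: ltnW].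
rewrite -(subnK le_kn); apply: le_trans (arec _) _.
have hB : 0 <= B / s ^+ k by rewrite divr_ge0 // ltW.
have h1 : a (n - k)%N <= B / s ^+ k * s ^+ (n - k).
  by apply: IH; rewrite ltn_subrL k0 (leq_trans k0 le_kn).
rewrite exprD mulrA [leRHS]mulrC.
apply: le_trans (ler_wpM2l (ltW r0) h1) _; apply: ler_wpM2r => //.
by rewrite mulr_ge0 // exprn_ge0 // ltW.
Qed.

(** A vanishing factor would give [x^k = 1] on taking [k]-th powers, against [Re (x^k) < 1 / 2]. *)
Lemma rank_den_zeta_neq0 n : rank_den zeta x n != 0.
Proof.
have h (y : C) j : y ^+ k != 1 -> 1 - y * zeta ^+ j != 0.
  apply: contra_neq => e; have : y * zeta ^+ j = 1 by apply/esym/eqP; rewrite -subr_eq0 e.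
  move=> /(congr1 (fun z => z ^+ k)); rewrite exprMn -exprM mulnC exprM.
  by rewrite (prim_expr_order zetaP) !expr1n mulr1.
apply/prodf_neq0 => i _; rewrite mulf_neq0 ?h ?xk_neq1 //.
by rewrite exprVn invr_eq1 xk_neq1.
Qed.

Lemma rank_term_cvg {T : Type} {F : set_system T} {FF : Filter F} (q : T -> C) n :
  q t @[t --> F] --> zeta -> rank_term x (q t) n @[t --> F] --> (rank_term x zeta n : C).
Proof.
move=> cq.
have cX m : q t ^+ m @[t --> F] --> (zeta ^+ m : C).
  elim: m => [|m IH]; first by under eq_fun do rewrite expr0; exact: cvg_cst.
  by rewrite exprS; under eq_fun do rewrite exprS; exact: ccvgM.
have c1 (y : C) m : 1 - y * q t ^+ m @[t --> F] --> (1 - y * zeta ^+ m : C).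
  rewrite -mulNr; apply: (eq_cvg_to (g := fun t => 1 + (- y) * q t ^+ m)).
    by move=> t; rewrite mulNr.
  exact: ccvgD (cvg_cst _) (ccvgM (cvg_cst _) (cX m)).
have cden : rank_den (q t) x n @[t --> F] --> (rank_den zeta x n : C).
  elim: n => [|m IH].
    apply: (eq_cvg_to (g := fun=> 1)) => [t|]; first by rewrite rank_den0.
    by rewrite rank_den0; exact: cvg_cst.
  rewrite rank_denS; apply: eq_cvg_to => [t|]; first by rewrite rank_denS.
  exact: ccvgM IH (ccvgM (c1 _ _) (c1 _ _)).
rewrite rank_term_rank_den; under eq_fun do rewrite rank_term_rank_den.
exact: ccvgM (cX _) (ccvgV (rank_den_zeta_neq0 _) cden).
Qed.

Theorem rank_gen_radial {T : Type} {F : set_system T} {FF : ProperFilter F} (rho : T -> R) :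
  rho t @[t --> F] --> (1 : R) -> (\forall t \near F, rho t <= 1) ->
  cvg (series (rank_term x zeta) @ \oo) /\
  rank_gen x ((rho t)%:C%C * zeta) @[t --> F] --> (rank_gen x zeta : C).
Proof.
move=> crho rho_le1.
have cq : (rho t)%:C%C * zeta @[t --> F] --> zeta.
  rewrite -[X in _ --> X]mul1r; apply: ccvgM; last exact: cvg_cst.
  by apply/cvg_ReIm; split => //=; exact: cvg_cst.
have [r [r0 r1 [rho0 /andP[rho00 rho01] contr]]] := rank_term_contract.
have r01 : 0 < r < 1 by apply/andP.
have [s /andP[s0 s1] dom] := geometric_domination r01.
(* The first [k] terms converge as [rho -> 1], so eventually each is at most [G zeta + 1], the [B]
   of [geometric_domination]. *)
pose G (q : C) := \sum_(i < k) cabs (rank_term x q i).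
have cG : G ((rho t)%:C%C * zeta) @[t --> F] --> G zeta.
  apply: cvg_big => [|i _]; first exact: add_continuous.
  by apply: cvg_cabs; exact: rank_term_cvg.
have G0 : 0 <= G zeta + 1 by rewrite addr_ge0 // sumr_ge0 // => i _; exact: cabs_ge0.
have [B' HB] := dom _ G0.
apply: (tannery (b := fun n => B' * s ^+ n)).
- by move=> n; exact: rank_term_cvg.
- have n1 : \forall t \near F, G ((rho t)%:C%C * zeta) <= G zeta + 1.
    by apply: (cvgr_le _ cG); rewrite ltrDl.
  have n2 : \forall t \near F, rho0 <= rho t by apply: (cvgr_ge _ crho).
  apply: filterS3 n1 n2 rho_le1 => t t1 t2 t3; apply: HB => [m|m lt_mk].
    by apply: contr; rewrite t2.
  apply: le_trans t1; rewrite /G (bigD1 (Ordinal lt_mk)) //= lerDl.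
  by apply: sumr_ge0 => i _; exact: cabs_ge0.
- by apply: is_cvg_geometric_series; rewrite gtr0_norm.
Qed.

Lemma rank_gen_root_of_unity : cvg (series (rank_term x zeta) @ \oo) ->
  rank_gen x zeta = (1 - ((1 - x ^+ k) * (1 - x ^- k))^-1)^-1 *
    \sum_(0 <= s < k) rank_term x zeta s.
Proof.
move=> cs; set D := _ * (1 - _).
(* At [Y = 1] the modulus of [D] is [2 - 2 Re (x^k) > 1], so [D] cannot be 1. *)
have D1 : 1 - D^-1 != 0.
  have := @cabs_block_center 1 ler01.
  rewrite !mulr1 -/D expr1n => hD.
  rewrite subr_eq0 eq_sym invr_eq1; apply/eqP => D1; move: hD; rewrite D1 cabs1 => hD.
  by move: xk; lra.
have sh m : rank_term x zeta (m + k) = D^-1 * rank_term x zeta m.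
  rewrite rank_term_shift mulrC -mulrA; congr (_ * _).
    have := @block_center m 1 1 (expr1n _ _); rewrite /= !mulr1 -/D => <-.
    by congr (_^-1).
  have -> : (2 * m * k + k ^ 2 = k * (2 * m + k))%N by rewrite !expnS expn0; lia.
  by rewrite exprM (prim_expr_order zetaP) expr1n mulr1.
have := lim_series_shift k cs.
have -> : (fun n => rank_term x zeta (n + k)) = (fun n => D^-1 * rank_term x zeta n).
  exact: funext.
rewrite lim_seriesZ // -/(rank_gen x zeta) => e.
apply: (mulfI D1); rewrite mulrA mulfV // mul1r mulrBl mul1r {1}e.
by rewrite addrK.
Qed.

End RootOfUnity.

(** * Roots of unity and the quantum set *)

Section ComplexExponential.
Variable R : realType.
Local Notation C := (Cplx R).
Implicit Types z : C.

Lemma CexpD z1 z2 : Cexp (z1 + z2) = Cexp z1 * Cexp z2.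
Proof.
case: z1 z2 => [a1 b1] [a2 b2]; rewrite /Cexp /= expRD cosD sinD.
by apply/eqP; rewrite eq_complex /=; apply/andP; split; apply/eqP; ring.
Qed.

Lemma Cexp0 : Cexp (0 : C) = 1.
Proof. by rewrite /Cexp /= expR0 cos0 sin0 mulr1 mulr0. Qed.

Lemma cabs_Cexp z : cabs (Cexp z) = expR (complex.Re z).
Proof.
apply/eqP; rewrite -(@eqrXn2 _ 2) ?cabs_ge0 ?expR_ge0 // cabs_sqr /= !exprMn.
by rewrite -mulrDr cos2Dsin2 mulr1.
Qed.

Lemma Cexp_neq0 z : Cexp z != 0.
Proof. by rewrite -cabs_gt0 cabs_Cexp expR_gt0. Qed.

Lemma CexpN z : Cexp (- z) = (Cexp z)^-1.
Proof.
by apply: (mulfI (Cexp_neq0 z)); rewrite -CexpD subrr Cexp0 mulfV ?Cexp_neq0.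
Qed.

Lemma CexpMn z n : Cexp (z * n%:R) = Cexp z ^+ n.
Proof.
elim: n => [|n IH]; first by rewrite mulr0 Cexp0.
by rewrite -natr1 mulrDr mulr1 CexpD IH exprSr.
Qed.

Lemma CexpMz z (n : int) : Cexp (z * n%:~R) = Cexp z ^ n.
Proof.
case: n => n; first exact: CexpMn.
by rewrite NegzE mulrNz mulrN CexpN -invr_expz -exprnP; congr (_^-1); exact: CexpMn.
Qed.

Definition cis (s : R) : C := Cexp (2 * Cpi_i R * (s%:C)%C).

Lemma cisE s : cis s = (cos (2 * pi * s) +i* sin (2 * pi * s))%C.
Proof.
have e : 2 * Cpi_i R * (s%:C)%C = (0 +i* (2 * pi * s))%C.
  by apply/eqP; rewrite eq_complex /=; apply/andP; split; apply/eqP; ring.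
by rewrite /cis e /Cexp /= expR0 !mul1r.
Qed.

Lemma cabs_cis s : cabs (cis s) = 1.
Proof.
apply/eqP; rewrite -(@eqrXn2 _ 2) ?cabs_ge0 // cisE cabs_sqr /= cos2Dsin2.
by rewrite expr1n.
Qed.

Lemma cisD s1 s2 : cis (s1 + s2) = cis s1 * cis s2.
Proof. by rewrite /cis rmorphD /= mulrDr CexpD. Qed.

Lemma cisMn s n : cis (s * n%:R) = cis s ^+ n.
Proof. by rewrite /cis rmorphM /= rmorph_nat mulrA CexpMn. Qed.

Lemma cis_int (l : int) : cis l%:~R = 1.
Proof.
have c1 : cis 1 = 1 by rewrite cisE mulr1 mulr_natl cos2pi sin2pi.
rewrite /cis rmorph_int CexpMz.
by move: c1; rewrite /cis /= mulr1 => ->; rewrite exp1rz.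
Qed.

(** By the half angle: [cos (2 pi s) = 1] would force [sin (pi s) = 0], yet [0 < pi s < pi]. *)
Lemma cis_neq1 s : 0 < s < 1 -> cis s != 1.
Proof.
move=> /andP[s0 s1]; have p0 := pi_gt0 R.
have : 0 < sin (pi * s) by apply: sin_gt0_pi; rewrite mulr_gt0 //= gtr_pMr.
apply: contraTneq; rewrite cisE => /(congr1 (@complex.Re R)) /=.
rewrite -mulrA mulr_natl mulr2n cosD.
have := cos2Dsin2 (pi * s); set a := cos _; set b := sin _ => h1 h2.
rewrite -leNgt.
have : b ^+ 2 = 0 by lra.
by move/eqP; rewrite sqrf_eq0 => /eqP ->.
Qed.

(** For [a = cos (pi / 3)], computing [cos (2 pi / 3)] as [- a] and as [2 a^2 - 1] gives
    [(2a - 1) (a + 1) = 0], and [a > 0]. *)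
Lemma cos_pi_third : cos (pi / 3) = 1 / 2 :> R.
Proof.
have p0 := pi_gt0 R.
have c0 : 0 < cos (pi / 3 : R) by apply: cos_gt0_pihalf; apply/andP; split; lra.
have e1 : cos (pi - pi / 3 : R) = - cos (pi / 3).
  by rewrite cosB cospi sinpi mul0r addr0 mulN1r.
have e2 : pi - pi / 3 = pi / 3 + pi / 3 :> R by field.
have := cos2Dsin2 (pi / 3 : R).
move: e1; rewrite e2 cosD.
move: c0; set a := cos _; set b := sin _ => c0 h1 h2.
have : (2 * a - 1) * (a + 1) = 0 by lra.
move/eqP; rewrite mulf_eq0 => /orP[] /eqP ?; lra.
Qed.

(** Modulo the integer, and up to sign, the angle is [2 pi d] with [1/6 < d <= 1/2]; it lies beyond
    [pi / 3] and at most at [pi], where the cosine decreases from [1/2]. *)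
Lemma Re_cis_lt (s : R) (l : int) : 1 / 6 < `|s - l%:~R| <= 1 / 2 ->
  complex.Re (cis s) < 1 / 2.
Proof.
move=> /andP[d1 d2]; have p0 := pi_gt0 R.
rewrite -[s](subrK l%:~R) cisD cis_int mulr1 cisE /=.
rewrite -cos_norm normrM (ger0_norm (_ : 0 <= 2 * pi)); last lra.
rewrite -cos_pi_third; move: d1 d2; set d := `|_| => d1 d2.
by rewrite ltr_cos ?in_itv /=; [nra|apply/andP; split; nra|apply/andP; split; nra].
Qed.

(** Let [m] be the exact order, which divides [k]. If [m < k], coprimality makes [h m mod k]
    nonzero, and [cis_neq1] contradicts [cis (h m / k) = 1]. *)
Lemma cis_primitive (h : int) (k : nat) : (0 < k)%N -> coprimez h k ->
  k.-primitive_root (cis (h%:~R / k%:R)).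
Proof.
move=> k0 hk; have kR : k%:R != 0 :> R by rewrite pnatr_eq0 -lt0n.
have kR0 : 0 < k%:R :> R by rewrite ltr0n.
have zk : cis (h%:~R / k%:R) ^+ k = 1 by rewrite -cisMn divfK // cis_int.
have [m mP mk] := prim_order_exists k0 zk.
have m0 := prim_order_gt0 mP.
have [lt_mk|] := ltnP m k; last first.
  move=> le_km; suff e : m = k by rewrite e in mP.
  by apply/eqP; rewrite eqn_leq le_km dvdn_leq.
have := prim_expr_order mP; rewrite -cisMn => /eqP.
set r := (h * m%:Z %% k%:Z)%Z.
have r0 : 0 <= r by apply: modz_ge0; lia.
have rk : r < k by apply: ltz_pmod; lia.
have rn0 : r != 0.
  apply/negP => /eqP e; have : (k%:Z %| h * m%:Z)%Z by apply/dvdz_mod0P.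
  rewrite Gauss_dvdzr 1?coprimez_sym // /dvdz !absz_nat => /(dvdn_leq m0).
  by rewrite leqNgt lt_mk.
have e : h%:~R / k%:R * m%:R = (h * m%:Z %/ k%:Z)%Z%:~R + r%:~R / k%:R :> R.
  have : (h * m%:Z)%:~R = ((h * m%:Z %/ k%:Z)%Z * k%:Z + r)%:~R :> R by rewrite -divz_eq.
  rewrite rmorphD !rmorphM /= => e; apply: (mulIf kR).
  by rewrite mulrDl divfK // mulrAC divfK.
rewrite e cisD cis_int mul1r => /eqP e1.
have /negP[] : cis (r%:~R / k%:R) != 1; last exact/eqP.
apply: cis_neq1; apply/andP; split.
  by rewrite divr_gt0 // ltr0z lt_def rn0.
by rewrite ltr_pdivrMr // mul1r (_ : k%:R = k%:~R) // ltr_int.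
Qed.

End ComplexExponential.

(** * From the distance condition to the real part of [x^k] *)

Lemma nearest_int_le (y : rat) (l : int) : nearest_int y l -> `|y - l%:~R| <= 1 / 2.
Proof.
move=> hl; move: (hl (l + 1)) (hl (l - 1)); rewrite intrB intrD.
have [d0|d0] := leP 0 (y - l%:~R); rewrite ?(ger0_norm d0) ?(ltr0_norm d0).
  have [d1|d1] := leP 0 (y - (l%:~R + 1)); rewrite ?(ger0_norm d1) ?(ltr0_norm d1); lra.
have [d1|d1] := leP 0 (y - (l%:~R - 1)); rewrite ?(ger0_norm d1) ?(ltr0_norm d1); lra.
Qed.

(** Membership in the quantum set supplies some reduced fraction; uniqueness of the denominator
    identifies it with the given [k]. *)
Lemma coprime_fraction_den (h h' : int) (k k' : nat) : (0 < k)%N -> (0 < k')%N ->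
  coprimez h k -> coprimez h' k' -> h%:~R / k%:R = h'%:~R / k'%:R :> rat -> k = k'.
Proof.
move=> k0 k0' c c' e.
have kq : k%:R != 0 :> rat by rewrite pnatr_eq0 -lt0n.
have kq' : k'%:R != 0 :> rat by rewrite pnatr_eq0 -lt0n.
have e1 : h * k'%:Z = h' * k%:Z.
  apply: (@intr_inj rat); rewrite !rmorphM /=.
  have -> : (h%:~R : rat) = h%:~R / k%:R * k%:R by rewrite divfK.
  by rewrite e mulrAC divfK.
have d1 : (k%:Z %| k'%:Z)%Z.
  by rewrite -(@Gauss_dvdzr _ h) 1?coprimez_sym // e1 dvdz_mull.
have d2 : (k'%:Z %| k%:Z)%Z.
  by rewrite -(@Gauss_dvdzr _ h') 1?coprimez_sym // -e1 dvdz_mull.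
by apply/eqP; rewrite eqn_dvd; apply/andP.
Qed.

Lemma quantum_set_Re_lt (R : realType) m (alpha : 'I_m -> int) (beta : 'I_m -> nat)
    (h : int) (k : nat) (j : 'I_m) : (0 < k)%N -> coprimez h k ->
  quantum_set alpha beta (h%:~R / k%:R) ->
  complex.Re (cis (ratr (alpha_over_beta alpha beta j) : R) ^+ k) < 1 / 2.
Proof.
move=> k0 hk [h' [k' [k0' hk' e H]]].
have ek := coprime_fraction_den k0 k0' hk hk' e; subst k'.
have [_ [l near_l gt_l]] := H j.
rewrite -cisMn; apply: (@Re_cis_lt _ _ l).
have le_l := nearest_int_le near_l.
have -> : ratr (alpha_over_beta alpha beta j) * k%:R - l%:~R =
    ratr (alpha_over_beta alpha beta j * k%:R - l%:~R) :> R.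
  by move: (alpha_over_beta alpha beta j) => y; rewrite rmorphB rmorphM /= ratr_int ratr_nat.
rewrite -ratr_norm.
have r6 : 1 / 6 = ratr (1 / 6) :> R by rewrite fmorph_div rmorph_nat rmorph1.
have r2 : 1 / 2 = ratr (1 / 2) :> R by rewrite fmorph_div rmorph_nat rmorph1.
by rewrite r6 r2 ltr_rat ler_rat gt_l le_l.
Qed.

(** * The Appell quotient in the disc and its vertical limit *)

Lemma appell3_quot_rank_gen (R : realType) (u tau : Cplx R) :
  let q := Cexp (2 * Cpi_i R * tau) in
  let x := Cexp (2 * Cpi_i R * u) in
  cabs q < 1 -> cabs x = 1 -> x != 1 ->
  appell3_quot u tau = Cexp (5 * Cpi_i R * u) / (1 - x) * rank_gen x q + Cexp (3 * Cpi_i R * u).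
Proof.
move=> q x q1 x1 xn1.
rewrite /appell3_quot /appell3 -/q -/x.
have q0 : q != 0 by exact: Cexp_neq0.
rewrite mulrCA [X in sum_int X](_ : _ = appell_term q x); last first.
  apply: funext => n; rewrite /appell_term -appell3_exponent //; congr (_ * _ / _).
  rewrite -CexpMz -/q rmorphN rmorphM /=; congr Cexp; ring.
rewrite appell_rank_disc // mulrDr mulr1; congr (_ + _).
have -> : 5 * Cpi_i R * u = 3 * Cpi_i R * u + 2 * Cpi_i R * u by ring.
by rewrite CexpD -/x; ring.
Qed.

Theorem theorem3p2 (R : realType) (n N : nat)
    (alpha : 'I_(n - N) -> int) (beta : 'I_(n - N) -> nat)
    (hn : (2 <= n)%N) (hN : (N <= n %/ 2)%N)
    (hab : admissible alpha beta)
    (h : int) (k : nat) (hk : (0 < k)%N) (hcop : coprimez h k)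
    (hQ : quantum_set alpha beta (h%:~R / k%:R))
    (j : 'I_(n - N)) :
  let u : Cplx R := ratr (alpha_over_beta alpha beta j) in
  let x : Cplx R := Cexp (2 * Cpi_i R * u) in
  let x52 : Cplx R := Cexp (5 * Cpi_i R * u) in
  let x32 : Cplx R := Cexp (3 * Cpi_i R * u) in
  let zeta : Cplx R := Cexp (2 * Cpi_i R * (h%:~R / k%:R)) in
  let F (t : R) : Cplx R := appell3_quot u (vertical (h%:~R / k%:R) t) in
  [/\ cvg (F t @[t --> 0^'+]),
      cvg (series (rank_term x zeta) @ \oo),
      lim (F t @[t --> 0^'+]) = x52 / (1 - x) * rank_gen x zeta + x32
    & x52 / (1 - x) * rank_gen x zeta + x32 =
      x52 / ((1 - x) * (1 - ((1 - x ^+ k) * (1 - x ^- k))^-1)) *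
        \sum_(0 <= s < k) (zeta ^+ (s ^ 2) /
          (qpoch (x * zeta) zeta s * qpoch (x^-1 * zeta) zeta s)) + x32].
Proof.
move=> u x x52 x32 zeta F.
have ux : x = cis (ratr (alpha_over_beta alpha beta j)).
  by rewrite /cis (fmorph_rat (real_complex R)).
have hkC : h%:~R / k%:R = ((h%:~R / k%:R : R)%:C)%C :> Cplx R.
  by rewrite fmorph_div /= rmorph_int rmorph_nat.
have zE : zeta = cis (h%:~R / k%:R) by rewrite /cis -hkC.
have zP : k.-primitive_root zeta by rewrite zE cis_primitive.
have x1 : cabs x = 1 by rewrite ux cabs_cis.
have xk : complex.Re (x ^+ k) < 1 / 2 by rewrite ux; exact: quantum_set_Re_lt hQ.
have xn1 : x != 1 by apply: contraNneq (xk_neq1 xk) => ->; rewrite expr1n.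
(* At [tau = h / k + i t] the nome [q] is [rho t] times [zeta], so [t -> 0+] is the radial approach
   from inside the disc. *)
pose rho (t : R) := expR (- (2 * pi * t)).
have qE t : Cexp (2 * Cpi_i R * vertical (h%:~R / k%:R) t) = ((rho t)%:C)%C * zeta.
  rewrite /vertical fmorph_div /= ratr_int ratr_nat mulrDr CexpD mulrC; congr (_ * _).
  have -> : 2 * Cpi_i R * (0 +i* t)%C = ((- (2 * pi * t))%:C)%C.
    by apply/eqP; rewrite eq_complex /=; apply/andP; split; apply/eqP; ring.
  by rewrite /Cexp /= cos0 sin0 mulr1 mulr0.
have z1 : cabs zeta = 1 by rewrite zE cabs_cis.
have crho : rho t @[t --> 0^'+] --> (1 : R).
  apply: cvg_at_right_filter.
  have -> : 1 = rho 0 by rewrite /rho mulr0 oppr0 expR0.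
  apply: (@continuous_comp _ _ _ (fun t : R => - (2 * pi * t)) expR); last exact: continuous_expR.
  by apply: continuousN; apply: continuousM; [exact: cst_continuous|exact: id].
have tpos : \forall t \near (0 : R)^'+, 0 < t by exact: nbhs_right_gt.
have rho_lt t : 0 < t -> rho t < 1.
  move=> t0; rewrite -expR0 ltr_expR oppr_lt0 !mulr_gt0 //; exact: pi_gt0.
have rho_le : \forall t \near (0 : R)^'+, rho t <= 1.
  by apply: filterS tpos => t t0; apply/ltW/rho_lt.
have [cs cR] := rank_gen_radial hk zP x1 xk crho rho_le.
(* The identity in the disc requires [|q| < 1], that is [t > 0]; the right-sided filter sees only
   such [t]. *)
have FE t : 0 < t -> x52 / (1 - x) * rank_gen x (((rho t)%:C)%C * zeta) + x32 = F t.
  move=> t0; rewrite -qE; apply: esym.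
  apply: appell3_quot_rank_gen x1 xn1; rewrite qE cabsM z1 mulr1.
  by rewrite (cabs_real (expR_ge0 _)); exact: rho_lt.
have cF : F t @[t --> 0^'+] --> (x52 / (1 - x) * rank_gen x zeta + x32 : Cplx R).
  apply: cvg_trans (ccvgD (ccvgM (cvg_cst (x52 / (1 - x))) cR) (cvg_cst x32)).
  by apply: near_eq_cvg; apply: filterS tpos => t t0; exact: FE.
split; [by apply/cvg_ex; eexists; exact: cF|exact: cs|exact: climP cF|].
rewrite (rank_gen_root_of_unity hk zP x1 xk cs) mulrA.
by congr (_ * _ + _); rewrite -mulrA -invfM.
Qed.
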